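(* For each $n\geq 3$ let $\nu_n$ be a cross measure on $S^{n-1}$. Then \[ \lim_{n \rightarrow \infty} \frac{\alpha_n}{\kappa_n\gamma_n^n}\, V(S_{\nu_n}^{*}) = \lim_{n \rightarrow \infty} \frac{\gamma_n^n}{\kappa_n\alpha_n}\, V(S_{\nu_n})=1 . \]
   Context: Let $\|\cdot\|$ and $x\cdot y$ denote the Euclidean norm and the standard inner product on $\mathbb{R}^n$, let $S^{n-1}$ be the unit sphere, and let $V$ denote volume (Lebesgue measure) in $\mathbb{R}^n$. A cross measure on $S^{n-1}$ is an isotropic measure concentrated uniformly on $\{\pm b_1,\ldots,\pm b_n\}$ for some orthonormal basis $b_1,\ldots,b_n$ of $\mathbb{R}^n$. Here isotropic means $\|x\|^2=\int_{S^{n-1}}|x\cdot u|^2\,d\mu(u)$ for all $x\in\mathbb{R}^n$, so a cross measure gives mass $1/2$ to each of the $2n$ points $\pm b_i$. The sine transform of a finite Borel measure $\mu$ on $S^{n-1}$ is \[(\mathcal{S}\mu)(x)=\int_{S^{n-1}}\|x|u^{\perp}\|\,d\mu(u),\qquad x\in\mathbb{R}^n,\] where $x|u^{\perp}=x-(x\cdot u)u$ is the orthogonal projection of $x$ onto the hyperplane $u^\perp$ orthogonal to $u$. For $\mu$ even and isotropic (in particular for cross measures), $\mathcal{S}\mu$ is a norm on $\mathbb{R}^n$. Its unit ball is $S_\mu^*=\{x\in\mathbb{R}^n:(\mathcal{S}\mu)(x)\leq 1\}$, and $S_\mu$ denotes the polar body of $S_\mu^*$, i.e. the convex body with support function $h(S_\mu,x)=\max\{x\cdot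 y:y\in S_\mu\}=(\mathcal{S}\mu)(x)$. Let $\kappa_m$ denote the $m$-dimensional volume of the Euclidean unit ball in $\mathbb{R}^m$, and put \[\alpha_n=\frac{n(n-1)^{2n}}{\Gamma(n)^{1/(n-1)}},\qquad \gamma_n=\frac{(n-1)\kappa_{n-1}^2}{\kappa_{n-2}\kappa_n}.\] *)

(* Defs.v *)
From HB Require Import structures.
From mathcomp Require Import all_boot all_order all_algebra.
From mathcomp Require Import all_classical all_reals all_analysis.

Set Implicit Arguments.
Unset Strict Implicit.
Unset Printing Implicit Defensive.

Import Order.TTheory GRing.Theory Num.Theory.
Import numFieldNormedType.Exports.

Local Open Scope classical_set_scope.
Local Open Scope ring_scope.

Section Euclidean.
Variables (R : realType) (n : nat).
Implicit Types (x y u : 'rV[R]_n) (A : set 'rV[R]_n).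

Definition dotp x y : R := \sum_(i < n) x ord0 i * y ord0 i.

(* The library norm `|x| on row vectors is the sup norm. *)
Definition enorm x : R := Num.sqrt (dotp x x).

Definition unit_ball : set 'rV[R]_n := [set x | enorm x <= 1].

Definition unit_sphere : set 'rV[R]_n := [set x | enorm x = 1].

Definition polar A : set 'rV[R]_n :=
  [set y | forall x, A x -> dotp x y <= 1].

(* Orthogonal projection of x onto the hyperplane orthogonal to the unit
   vector u. *)
Definition proj_perp x u : 'rV[R]_n := x - dotp x u *: u.

(* n orthonormal vectors of R^n are automatically a basis. *)
Definition orthonormal_basis (b : 'I_n -> 'rV[R]_n) : Prop :=
  forall i j, dotp (b i) (b j) = (i == j)%:R.

(* R^n with its Borel sigma-algebra. *)
Definition borel_rV := g_sigma_algebraType (@open 'rV[R]_n).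

End Euclidean.
Arguments unit_ball R n : clear implicits.
Arguments unit_sphere R n : clear implicits.

(* Lebesgue measure on R^n, as the n-fold product of Lebesgue measure on R. *)
Section Volume.
Variable R : realType.

Fixpoint Rprod_display (n : nat) : measure_display :=
  if n is n'.+1
  then ((R.-ocitv.-measurable).-sigma, Rprod_display n').-prod%mdisp
  else default_measure_display.

Fixpoint Rprod (n : nat) : measurableType (Rprod_display n) :=
  match n return measurableType (Rprod_display n) with
  | 0 => unit
  | n'.+1 => (measurableTypeR R * Rprod n')%type
  end.

Fixpoint lebesgue_prod (n : nat) : set (Rprod n) -> \bar R :=
  match n return set (Rprod n) -> \bar R with
  | 0 => \d_tt
  | n'.+1 => (lebesgue_measure \x @lebesgue_prod n')%E
  end.

Fixpoint row_of_Rprod (n : nat) : Rprod n -> 'rV[R]_n :=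
  match n return Rprod n -> 'rV[R]_n with
  | 0 => fun=> 0
  | n'.+1 => fun p => row_mx (p.1)%:M (row_of_Rprod p.2)
  end.

(* fine maps +oo to 0, so this is the volume only for sets of finite measure. *)
Definition volume (n : nat) (A : set 'rV[R]_n) : R :=
  fine (@lebesgue_prod n (@row_of_Rprod n @^-1` A)).

End Volume.

Section SphereMeasures.
Variables (R : realType) (n : nat).

(* A finite Borel measure on the sphere is encoded as a finite Borel measure on
   R^n that vanishes on the complement of the sphere. *)
Implicit Types mu : {finite_measure set (borel_rV R n) -> \bar R}.

Definition on_sphere mu : Prop := mu (~` unit_sphere R n) = 0%E.

Definition isotropic mu : Prop :=
  forall x : 'rV[R]_n,
    ((enorm x ^+ 2)%:E =
     \int[mu]_(u in unit_sphere R n) ((`|dotp x u| ^+ 2)%:E))%E.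

(* The common mass c is left free; isotropy forces it to be 1/2. *)
Definition cross_measure mu : Prop :=
  [/\ on_sphere mu, isotropic mu &
    exists b : 'I_n -> 'rV[R]_n, exists c : \bar R,
      [/\ orthonormal_basis b,
          mu (~` [set u | exists i, u = b i \/ u = - b i]) = 0%E &
          forall i, mu [set b i] = c /\ mu [set - b i] = c]].

Definition sine_transform mu (x : 'rV[R]_n) : R :=
  \int[mu]_(u in unit_sphere R n) enorm (proj_perp x u).

Definition sine_polar_body mu : set 'rV[R]_n :=
  [set x | sine_transform mu x <= 1].

Definition sine_body mu : set 'rV[R]_n := polar (sine_polar_body mu).

End SphereMeasures.

Section Constants.
Variable R : realType.

Definition kappa (m : nat) : R := volume (unit_ball R m).

Definition Gamma (x : R) : R :=
  \int[lebesgue_measure]_(t in `]0, +oo[) (t `^ (x - 1) * expR (- t)).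

Definition alpha (n : nat) : R :=
  n%:R * (n%:R - 1) ^+ (2 * n) / Gamma n%:R `^ (n%:R - 1)^-1.

Definition gamma (n : nat) : R :=
  (n%:R - 1) * kappa (n - 1) ^+ 2 / (kappa (n - 2) * kappa n).

End Constants.
Arguments kappa R m : clear implicits.
Arguments alpha R n : clear implicits.
Arguments gamma R n : clear implicits.

(* Main.v *)
(** Let [b] be the orthonormal basis of the cross measure. Isotropy forces mass
    1/2 at each [b_i] and [- b_i], so the sine transform is
    [h x = \sum_i sqrt (|x|^2 - (x . b_i)^2)], and Parseval's identity for [b] is
    the isotropy condition itself. On unit vectors [h] lies between [n - 1] and
    [sqrt (n (n - 1))], and all but a small part of the sphere satisfies
    [(x . b_i)^2 <= e] for all [i], where [e = n^(-1/2)]; there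
    [h >= n - (1 + e) / 2]. Dually, for such a unit vector [t], the point [l t] with
    [l = n + 1/2 - (1 - e)^(-1/2)] lies in the polar of the unit ball of [h], because
    [l <= \sum_(i != j) (1 - (t . b_i)^2)^(-1/2)] for all [j] and one can apply
    Cauchy-Schwarz. The exceptional vectors of a ball of radius [r] lie in [2 n]
    balls of radius [r sqrt (1 - e)], whose total volume is negligible. So only
    volumes of balls are compared, and both
    [n^n V(P) / kappa_n] and [kappa_n n^n / V(S)], where [P] is the unit ball of [h]
    and [S] its polar, tend to [e^(1/2)].
    It remains to see that [(gamma_n / n)^n] tends to [e^(-1/2)], by the recurrence
    and the log-convexity of the integrals of [(1 - t^2)^(n/2)], and that
    [alpha_n / n^(2n)] tends to [e^(-1)], by elementary bounds on [Gamma n]. *)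
Require Import Defs.
From HB Require Import structures.
From mathcomp Require Import all_boot all_order all_algebra.
From mathcomp Require Import all_classical all_reals all_analysis.
From mathcomp Require Import measurable_realfun.
From mathcomp Require Import ring lra.

Set Implicit Arguments.
Unset Strict Implicit.
Unset Printing Implicit Defensive.

Import Order.TTheory GRing.Theory Num.Theory.
Import numFieldNormedType.Exports.

Local Open Scope classical_set_scope.
Local Open Scope ring_scope.

(** * Euclidean geometry of row vectors *)

Section EuclideanFacts.
Variables (R : realType) (n : nat).
Implicit Types (x y z : 'rV[R]_n) (a : R).

Lemma dotpC x y : dotp x y = dotp y x.
Proof. by apply: eq_bigr => i _; rewrite mulrC. Qed.

Lemma dotpDl x y z : dotp (x + y) z = dotp x z + dotp y z.
Proof. by rewrite -big_split; apply: eq_bigr => i _; rewrite mxE mulrDl. Qed.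

Lemma dotpZl a x y : dotp (a *: x) y = a * dotp x y.
Proof. by rewrite mulr_sumr; apply: eq_bigr => i _; rewrite mxE mulrA. Qed.

Lemma dotpNl x y : dotp (- x) y = - dotp x y.
Proof. by rewrite -scaleN1r dotpZl mulN1r. Qed.

Lemma dotpDr x y z : dotp x (y + z) = dotp x y + dotp x z.
Proof. by rewrite dotpC dotpDl !(dotpC x). Qed.

Lemma dotpZr a x y : dotp x (a *: y) = a * dotp x y.
Proof. by rewrite dotpC dotpZl dotpC. Qed.

Lemma dotpNr x y : dotp x (- y) = - dotp x y.
Proof. by rewrite dotpC dotpNl dotpC. Qed.

Lemma dotpxx_ge0 x : 0 <= dotp x x.
Proof. by apply: sumr_ge0 => i _; rewrite -expr2 sqr_ge0. Qed.

Lemma enorm_ge0 x : 0 <= enorm x.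
Proof. exact: sqrtr_ge0. Qed.

Lemma sqr_enorm x : enorm x ^+ 2 = dotp x x.
Proof. by rewrite sqr_sqrtr ?dotpxx_ge0. Qed.

Lemma enorm_le x a : 0 <= a -> (enorm x <= a) = (dotp x x <= a ^+ 2).
Proof. by move=> a0; rewrite -sqr_enorm ler_pXn2r ?nnegrE ?enorm_ge0. Qed.

Lemma enormN x : enorm (- x) = enorm x.
Proof. by rewrite /enorm dotpNl dotpNr opprK. Qed.

Lemma dotp_continuous y : continuous (fun x => dotp x y).
Proof.
apply: continuous_big => [|i _ x]; first exact: add_continuous.
apply: (@continuousM R _ (fun x : 'rV[R]_n => x ord0 i)); last exact: cst_continuous.
exact: coord_continuous.
Qed.

Lemma dotpxx_continuous : continuous (fun x => dotp x x).
Proof.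
apply: continuous_big => [|i _ x]; first exact: add_continuous.
by apply: (@continuousM R _ (fun x : 'rV[R]_n => x ord0 i)); exact: coord_continuous.
Qed.

Lemma enorm_continuous : continuous (@enorm R n).
Proof.
move=> x; apply: (@continuous_comp _ _ _ (fun x => dotp x x) Num.sqrt).
  exact: dotpxx_continuous.
exact: sqrt_continuous.
Qed.

Definition cball (c : 'rV[R]_n) (r : R) : set 'rV[R]_n :=
  [set x | enorm (x - c) <= r].

Lemma cball0E r : cball 0 r = [set x | enorm x <= r].
Proof. by apply/seteqP; split => x; rewrite /cball /= subr0. Qed.

Lemma closed_le_continuous (f : 'rV[R]_n -> R) a : continuous f ->
  closed [set x | f x <= a].
Proof.
move=> cf; rewrite [X in closed X](_ : _ = f @^-1` [set y | y <= a]) //.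
by apply: closed_comp => [x _|]; [exact: cf|exact: closed_le].
Qed.

Lemma closed_cball c r : closed (cball c r).
Proof.
apply: closed_le_continuous => x.
apply: (@continuous_comp _ _ _ (fun x => x - c) (@enorm R n)); last exact: enorm_continuous.
by apply: continuousB; [exact: cvg_id|exact: cst_continuous].
Qed.

End EuclideanFacts.

(** * Lebesgue measure on row vectors *)

Section ProductMeasure.
Context d1 d2 (T1 : measurableType d1) (T2 : measurableType d2) (R : realType).
Variables (m1 : {sigma_finite_measure set T1 -> \bar R})
          (m2 : {sigma_finite_measure set T2 -> \bar R}).

(* The library's sigma-finite instance on [m1 \x m2] is shadowed by a later
   subprobability instance, hence this copy. *)
Definition sigma_finite_prod : set (T1 * T2)%type -> \bar R := (m1 \x m2)%E.

HB.instance Definition _ := Measure.on sigma_finite_prod.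

Lemma sigma_finite_prodT : sigma_finite setT sigma_finite_prod.
Proof.
have /sigma_finiteP[F [TF ndF Foo]] := sigma_finiteT m1.
have /sigma_finiteP[G [TG ndG Goo]] := sigma_finiteT m2.
exists (fun n => F n `*` G n).
  rewrite -setXTT TF TG predeqE => -[x y]; split.
    move=> [/= [n _ Fnx] [k _ Gky]]; exists (maxn n k) => //; split.
    - by move: x Fnx; exact/subsetPset/ndF/leq_maxl.
    - by move: y Gky; exact/subsetPset/ndG/leq_maxr.
  by move=> [n _ []/= ? ?]; split; exists n.
move=> k; have [? ?] := Foo k; have [? ?] := Goo k.
split; first exact: measurableX.
by rewrite [ltLHS]product_measure1E// lte_mul_pinfty// ge0_fin_numE.
Qed.

HB.instance Definition _ :=
  Measure_isSigmaFinite.Build _ _ _ sigma_finite_prod sigma_finite_prodT.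

End ProductMeasure.

Section LebesgueProd.
Variable R : realType.

Definition dirac_unit : {sigma_finite_measure set unit -> \bar R} := \d_tt.

(** The recursion of [lebesgue_prod] with sigma-finiteness carried along, so that each stage is
    again a measure and can be multiplied once more. *)
Fixpoint lebesgue_prodm (n : nat) :
    {sigma_finite_measure set (Rprod R n) -> \bar R} :=
  match n return {sigma_finite_measure set (Rprod R n) -> \bar R} with
  | 0 => dirac_unit
  | n'.+1 => sigma_finite_prod lebesgue_measure (lebesgue_prodm n')
  end.

Lemma lebesgue_prodE n : @lebesgue_prod R n = lebesgue_prodm n.
Proof. by elim: n => [//|n IHn] /=; rewrite IHn. Qed.

Lemma measurable_coord n (i : 'I_n) :
  measurable_fun setT (fun p : Rprod R n => row_of_Rprod p ord0 i).
Proof.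
elim: n i => [[]//|n IHn] i.
case: (@split_ordP 1 n i) => j -> /=.
  rewrite (_ : (fun _ => _) = fst); first exact: measurable_fst.
  apply/funext => p; rewrite -[LHS]/(row_mx (p.1)%:M (row_of_Rprod p.2) ord0 (lshift n j)).
  by rewrite row_mxEl mxE (ord1 j) mulr1n.
rewrite (_ : (fun _ => _) = (fun p => row_of_Rprod p ord0 j) \o snd).
  exact: measurableT_comp.
apply/funext => p; rewrite -[LHS]/(row_mx (p.1)%:M (row_of_Rprod p.2) ord0 (rshift 1 j)).
by rewrite row_mxEr.
Qed.


(** The preimage is the union of the boxes inside it with rational centre and radius 1 / (k + 1).
    There are countably many, and finitely many measurable coordinates cut out each. *)
Lemma measurable_preimage_open n (U : set 'rV[R]_n) : open U ->
  measurable (@row_of_Rprod R n @^-1` U).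
Proof.
move=> oU.
pose box (q : 'rV[rat]_n * nat) : set (Rprod R n) :=
  \bigcap_(i in [set: 'I_n])
    ((fun p => row_of_Rprod p ord0 i) @^-1` ball (ratr (q.1 ord0 i) : R) q.2.+1%:R^-1).
have mbox q : measurable (box q).
  apply: fin_bigcap_measurable => [|i _]; first exact: finite_finset.
  rewrite -[X in measurable X]setTI; apply: measurable_coord => //.
  exact: measurable_ball.
pose F q := if `[< box q `<=` @row_of_Rprod R n @^-1` U >] then box q else set0.
rewrite (_ : _ @^-1` _ = \bigcup_q F q).
  by apply: countable_bigcupT_measurable => // q; rewrite /F; case: ifP.
apply/seteqP; split => [p Up|p [q _]]; last first.
  by rewrite /F; case: asboolP => // + bqp; exact.
have /nbhs_ballP[e /= e0 eU] : nbhs (row_of_Rprod p) U by exact: open_nbhs_nbhs.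
(* A point of the box is within the radius of the rational centre, and so is the given point. Radius
   below e / 2 keeps the box inside the e-ball. *)
have e20 : 0 < e / 2 by rewrite divr_gt0.
have [k] := ltr_add_invr e20; rewrite add0r => ke.
have k0 : 0 < k.+1%:R^-1 :> R by rewrite invr_gt0.
have [d dE] : exists d : R, d = k.+1%:R^-1 by exists k.+1%:R^-1.
rewrite -dE in ke k0.
have /choice[q qP] : forall i : 'I_n, exists q : rat,
    ball (ratr q : R) d (row_of_Rprod p ord0 i).
  move=> i; set x := row_of_Rprod p ord0 i.
  have /rat_in_itvoo[q] : x - d < x + d by lra.
  rewrite in_itv /= => /andP[q1 q2]; exists q.
  by rewrite /ball /= ltr_norml; apply/andP; split; lra.
exists (\row_i q i, k) => //; rewrite /F asboolT.
  by move=> i _ /=; rewrite mxE -dE; exact: qP.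
move=> p' bp' /=; apply: eU; split => // i j; rewrite ord1.
have := bp' j I; have := qP j; rewrite /= mxE -dE /ball /= !ltr_norml => /andP[? ?] /andP[? ?].
by apply/andP; split; lra.
Qed.

Lemma measurable_preimage_closed n (A : set 'rV[R]_n) : closed A ->
  measurable (@row_of_Rprod R n @^-1` A).
Proof.
move=> cA; have /measurableC := measurable_preimage_open (closed_openC cA).
by rewrite -preimage_setC setCK.
Qed.

(** Comparisons are made before [fine] is applied: with +oo sent to 0, [volume] itself need not be
    monotone. *)
Definition ext_volume n (A : set 'rV[R]_n) : \bar R :=
  lebesgue_prodm n (@row_of_Rprod R n @^-1` A).

Lemma volumeE n (A : set 'rV[R]_n) : volume A = fine (ext_volume A).
Proof. by rewrite /volume lebesgue_prodE. Qed.

Lemma dotp_row_mx n (a b : R) (x y : 'rV[R]_n) :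
  dotp (row_mx a%:M x : 'rV[R]_(1 + n)) (row_mx b%:M y) = a * b + dotp x y.
Proof.
rewrite /dotp big_split_ord big_ord1 /= !row_mxEl !mxE !mulr1n; congr (_ + _).
by apply: eq_bigr => i _; rewrite !row_mxEr.
Qed.

(** Pythagoras: the first coordinate uses up (t - a)^2 of the budget r^2. This is the slice for the
    Cavalieri induction in [ext_volume_cball]. *)
Lemma xsection_cball n (a : R) (c : 'rV[R]_n) (r t : R) : 0 <= r ->
  xsection (@row_of_Rprod R n.+1 @^-1` cball (row_mx a%:M c : 'rV[R]_(1 + n)) r) t =
  if `|t - a| <= r then
    @row_of_Rprod R n @^-1` cball c (Num.sqrt (r ^+ 2 - (t - a) ^+ 2)) else set0.
Proof.
move=> r0.
have rowB (x : 'rV[R]_n) : (row_mx t%:M x : 'rV[R]_(1 + n)) - row_mx a%:M c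
    = row_mx (t - a)%:M (x - c).
  by rewrite opp_row_mx add_row_mx raddfB.
have rE : (`|t - a| <= r) = ((t - a) ^+ 2 <= r ^+ 2).
  by rewrite -(real_normK (num_real (t - a))) ler_pXn2r ?nnegrE.
apply/seteqP; split => [p|p].
  rewrite /xsection /= inE /cball /= rowB enorm_le // dotp_row_mx -expr2 => h.
  have h' : (t - a) ^+ 2 <= r ^+ 2 by apply: le_trans h; rewrite lerDl dotpxx_ge0.
  by rewrite rE h' /= enorm_le ?sqrtr_ge0 // sqr_sqrtr ?subr_ge0 // lerBrDl.
rewrite rE; case: ifPn => // h.
rewrite /cball /= enorm_le ?sqrtr_ge0 // sqr_sqrtr ?subr_ge0 // lerBrDl => h'.
by rewrite /xsection /= inE /cball /= rowB enorm_le // dotp_row_mx.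
Qed.

End LebesgueProd.

(** * Volumes of balls *)

Section BallVolume.
Variable R : realType.
Local Notation mu := (@lebesgue_measure R).

(** With t = sin s this is the integral of cos^(n+1) over [-pi/2, pi/2]; by [kappaE] it equals
    kappa_(n+1) / kappa_n. *)
Definition wallis (n : nat) : R :=
  \int[mu]_(t in `[-1, 1]) Num.sqrt (1 - t ^+ 2) ^+ n.

Lemma continuous_semicircle (a r : R) n :
  continuous (fun t : R => Num.sqrt (r ^+ 2 - (t - a) ^+ 2) ^+ n).
Proof.
move=> t; apply: (cvg_comp _ (fun x : R => x ^+ n)); last exact: exprn_continuous.
apply: (cvg_comp _ Num.sqrt); last exact: sqrt_continuous.
apply: cvgB; first exact: cvg_cst.
apply: (cvg_comp _ (fun x : R => x ^+ 2)); last exact: exprn_continuous.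
by apply: cvgB; [exact: cvg_id|exact: cvg_cst].
Qed.

Lemma integrable_wallis n :
  mu.-integrable `[-1, 1] (fun t => (Num.sqrt (1 - t ^+ 2) ^+ n)%:E).
Proof.
apply: continuous_compact_integrable; first exact: segment_compact.
apply: continuous_subspaceT => t.
have := @continuous_semicircle 0 1 n t.
by under [in X in X -> _]eq_fun do rewrite subr0 expr1n.
Qed.

Lemma wallisE n :
  (wallis n)%:E = (\int[mu]_(t in `[(- 1)%R, 1%R]) (Num.sqrt (1 - t ^+ 2) ^+ n)%:E)%E.
Proof. by rewrite /wallis /Rintegral fineK // integrable_fin_num // integrable_wallis. Qed.

Lemma is_derive_affine (a r t : R) : is_derive t 1 (fun u : R => a + r * u) r.
Proof.
by apply: is_derive_eq; rewrite add0r /GRing.scale /= mul1r mulr1.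
Qed.

(** Substitution t = a + r u. The case r = 0 is separate, since the substitution must be strictly
    increasing. *)
Lemma integral_semicircle n (a r : R) : 0 <= r ->
  (\int[mu]_(t in `[(a - r)%R, (a + r)%R]) (Num.sqrt (r ^+ 2 - (t - a) ^+ 2) ^+ n)%:E
    = (r ^+ n.+1 * wallis n)%:E)%E.
Proof.
rewrite le_eqVlt => /predU1P[<-|r0].
  by rewrite subr0 addr0 set_itv1 integral_set1 exprS !mul0r.
pose F := fun u : R => a + r * u.
have -> : a - r = F (-1) by rewrite /F mulrN1.
have -> : a + r = F 1 by rewrite /F mulr1.
have dF : derive1 F = cst r.
  by apply/funext => t; rewrite derive1E; have := is_derive_affine a r t => -[_ ->].
have cF : continuous F.
  by move=> t; apply/differentiable_continuous/derivable1_diffP; have [] :=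
    is_derive_affine a r t.
rewrite (@integration_by_substitution_increasing R F); first last.
- by apply: continuous_subspaceT; exact: continuous_semicircle.
- split.
  + by move=> t _; have [] := is_derive_affine a r t.
  + by apply: cvg_at_right_filter; exact: cF.
  + by apply: cvg_at_left_filter; exact: cF.
- by rewrite dF; exact: is_cvg_cst.
- by rewrite dF; exact: is_cvg_cst.
- by move=> t _; rewrite dF; exact: cst_continuous.
- by move=> x y _ _ xy; rewrite /F ltrD2l ltr_pM2l.
- by lra.
rewrite EFinM wallisE -integralZl //; last exact: integrable_wallis.
apply: eq_integral => u; rewrite inE /= in_itv /= => /andP[u1 u2].
rewrite dF /F /= -EFinM; congr (_%:E).
transitivity (Num.sqrt (r ^+ 2 - (a + r * u - a) ^+ 2) ^+ n * r) => //.
rewrite (_ : r ^+ 2 - _ = r ^+ 2 * (1 - u ^+ 2)); last by ring.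
by rewrite sqrtrM ?sqr_ge0 // sqrtr_sqr ger0_norm ?(ltW r0) // exprMn (exprS r n) mulrC mulrA.
Qed.

(** Cavalieri: the slices are balls of one dimension less, and integrating their volumes contributes
    one more Wallis factor and one more power of r. *)
Lemma ext_volume_cball n (c : 'rV[R]_n) (r : R) : 0 <= r ->
  ext_volume (cball c r) = (r ^+ n * \prod_(k < n) wallis k)%:E.
Proof.
elim: n c r => [|n IHn] c r r0.
  rewrite /ext_volume /= expr0 big_ord0 mul1r /dirac_unit /= diracE mem_set //=.
  by rewrite /cball /= /enorm /dotp big_ord0 sqrtr0.
rewrite -(@hsubmxK _ 1 1 n c) (mx11_scalar (lsubmx _)); set a := lsubmx _ _ _.
transitivity (\int[mu]_t (if `|t - a| <= r then
    Num.sqrt (r ^+ 2 - (t - a) ^+ 2) ^+ n * \prod_(k < n) wallis k else 0)%:E)%E.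
  apply: eq_integral => t _; rewrite /= xsection_cball //.
  by case: ifPn => // tr; [exact: IHn (sqrtr_ge0 _)|rewrite measure0].
transitivity (\int[mu]_(t in `[(a - r)%R, (a + r)%R])
   ((\prod_(k < n) wallis k)%:E * (Num.sqrt (r ^+ 2 - (t - a) ^+ 2) ^+ n)%:E)%E)%E.
  rewrite [RHS]integral_mkcond; apply: eq_integral => t _; rewrite patchE.
  rewrite (_ : (t \in _) = (`|t - a| <= r)); last first.
    rewrite ler_distl; apply/idP/idP; rewrite inE /= in_itv /=; lra.
  by case: ifP => // _; rewrite mulrC.
rewrite integralZl //; last first.
  apply: continuous_compact_integrable; first exact: segment_compact.
  by apply: continuous_subspaceT => t; exact: continuous_semicircle.
by rewrite integral_semicircle // -EFinM big_ord_recr /=; congr (_%:E); ring.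
Qed.

Lemma kappaE n : kappa R n = \prod_(k < n) wallis k.
Proof.
have := @ext_volume_cball n 0 1 ler01; rewrite expr1n mul1r cball0E => h.
by rewrite /kappa volumeE h.
Qed.

Lemma ext_volume_cball_kappa n (c : 'rV[R]_n) (r : R) : 0 <= r ->
  ext_volume (cball c r) = (r ^+ n * kappa R n)%:E.
Proof. by rewrite kappaE; exact: ext_volume_cball. Qed.

End BallVolume.

(** * Recurrence and log-convexity of the Wallis integrals *)

Section WallisIntegrals.
Variable R : realType.
Local Notation mu := (@lebesgue_measure R).
Local Notation W := (@wallis R).

Lemma integrable_wallisZ (k : R) n :
  mu.-integrable `[-1, 1] (EFin \o (fun t => k * Num.sqrt (1 - t ^+ 2) ^+ n)).
Proof.
have : mu.-integrable `[-1, 1] (fun t => k%:E * (Num.sqrt (1 - t ^+ 2) ^+ n)%:E)%E.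
  by apply: integrableZl => //; exact: integrable_wallis.
by apply: eq_integrable => // t _; rewrite /= EFinM.
Qed.

(** With s = sqrt (1 - t^2), the function t s^(n+2) vanishes at both endpoints, so its derivative
    (n+3) s^(n+2) - (n+2) s^n has integral 0. *)
Lemma wallis_rec n : n.+3%:R * W n.+2 = n.+2%:R * W n.
Proof.
pose s := fun t : R => Num.sqrt (1 - t ^+ 2).
have cs m : continuous (fun t => s t ^+ m).
  move=> t; have := @continuous_semicircle R 0 1 m t.
  by under [in X in X -> _]eq_fun do rewrite subr0 expr1n.
have ds (t : R) : -1 < t < 1 -> is_derive t 1 s (- t / s t).
  move=> /andP[t1 t2]; have st : 0 < 1 - t ^+ 2.
    by rewrite (_ : _ - _ = (1 - t) * (1 + t)); [apply: mulr_gt0; lra|ring].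
  have d1 : is_derive t 1 (fun t : R => 1 - t ^+ 2) (- (2 * t)).
    by apply: is_derive_eq; rewrite /GRing.scale /=; ring.
  have := @is_derive1_comp R Num.sqrt (fun t => 1 - t ^+ 2) t _ _ (is_derive1_sqrt st) d1.
  move=> /is_derive_eq; apply.
  by rewrite -/(s t) invfM mulrN mulrACA mulVf ?pnatr_eq0 // mul1r mulNr mulrC.
pose F (t : R) := t * s t ^+ n.+2.
pose f (t : R) := n.+3%:R * s t ^+ n.+2 - n.+2%:R * s t ^+ n.
have dF (t : R) : -1 < t < 1 -> is_derive t 1 F (f t).
  move=> /[dup] /ds dst /andP[t1 t2]; have st : 0 < 1 - t ^+ 2.
    by rewrite (_ : _ - _ = (1 - t) * (1 + t)); [apply: mulr_gt0; lra|ring].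
  have s0 : s t != 0 by rewrite gt_eqF // sqrtr_gt0.
  have s2 : s t ^+ 2 = 1 - t ^+ 2 by rewrite sqr_sqrtr // ltW.
  have FE : F = id * s ^+ n.+2 by apply/funext => x; rewrite /F fctE exprfctE.
  have := is_deriveM (is_derive_id t 1) (is_deriveX n.+2 dst).
  rewrite -FE => /is_derive_eq; apply; rewrite /GRing.scale /= /f exprfctE -[n.+3%:R]natr1.
  move: s0 s2; set a := s t => s0 s2; rewrite (_ : a ^+ n.+2 = (1 - t ^+ 2) * a ^+ n); last
    by rewrite -s2 -exprD.
  rewrite (exprS a n).
  have -> : t * (n.+2%:R * (a * a ^+ n) * (- t / a)) = - (n.+2%:R * t ^+ 2 * a ^+ n) by field.
  by rewrite mulr1; ring.
have cF : continuous F.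
  by move=> t; apply: cvgM; [exact: cvg_id|exact: cs].
have cf : continuous f.
  by move=> t; apply: cvgB; (apply: cvgM; [exact: cvg_cst|exact: cs]).
(* The derivative of s is only available inside the interval; continuity of [F] covers the
   endpoints. *)
have : (\int[mu]_(t in `[(-1)%R, 1%R]) (f t)%:E = (F 1)%:E - (F (-1))%:E)%E.
  apply: continuous_FTC2 => //.
  - by apply: continuous_subspaceT.
  - split; [|exact: cvg_at_right_filter (cF _)|exact: cvg_at_left_filter (cF _)].
    by move=> t; rewrite in_itv /= => /dF [].
  - by move=> t; rewrite in_itv /= derive1E => /dF ?; exact: derive_val.
have F1 : F 1 = 0 by rewrite /F /s expr1n subrr sqrtr0 expr0n mulr0.
have FN1 : F (-1) = 0 by rewrite /F /s sqrrN expr1n subrr sqrtr0 expr0n mulr0.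
rewrite F1 FN1 => /(congr1 fine) /=; rewrite subr0 => h.
apply/subr0_eq; rewrite -[RHS]h -/(Rintegral mu _ f) RintegralB //.
- by rewrite !RintegralZl //; exact: integrable_wallis.
- exact: integrable_wallisZ.
- exact: integrable_wallisZ.
Qed.

Lemma wallis_le n : W n.+1 <= W n.
Proof.
apply: le_Rintegral => //; try exact: integrable_wallis.
move=> t _; rewrite exprS ler_piMl ?exprn_ge0 ?sqrtr_ge0 //.
by rewrite -[leRHS]sqrtr1 ler_wsqrtr // gerBl sqr_ge0.
Qed.

(** Even indices follow from W 0 = 2 by the recurrence. For the others, W n is at least W (2n) by
    monotonicity. *)
Lemma wallis_gt0 n : 0 < W n.
Proof.
suff h m : (0 < W m.*2) by apply: lt_le_trans (h n) _; rewrite -addnn;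
  elim: {1}n => // m IHm; rewrite addSn; exact: le_trans (wallis_le _) IHm.
elim: m => [|m IHm].
  rewrite /wallis (_ : (fun _ => _) = cst 1); last by apply/funext => t; rewrite expr0.
  have -> : \int[mu]_(t in `[-1, 1]) cst 1 t = 2; last by [].
  have := @lebesgue_measure_itv R `[-1, 1]; rewrite /= lte_fin ifT; last by lra.
  by move=> /(congr1 fine) /= h; rewrite Rintegral_cst // mul1r [LHS]h; lra.
rewrite doubleS -(pmulr_rgt0 _ (_ : 0 < m.*2.+3%:R)) ?ltr0n //.
by rewrite wallis_rec mulr_gt0.
Qed.

(* Nonnegativity of the integral of [s ^+ n * (l - s) ^+ 2] at the minimising l. *)
Lemma wallis_log_convex n : W n.+1 ^+ 2 <= W n * W n.+2.
Proof.
pose s := fun t : R => Num.sqrt (1 - t ^+ 2).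
pose l := W n.+1 / W n.
have : 0 <= \int[mu]_(t in `[-1, 1]) (l ^+ 2 * s t ^+ n + - (2 * l) * s t ^+ n.+1 + s t ^+
  n.+2).
  apply: Rintegral_ge0 => t _.
  rewrite (_ : _ + _ = s t ^+ n * (l - s t) ^+ 2); last by rewrite !exprS; ring.
  by rewrite mulr_ge0 ?sqr_ge0 ?exprn_ge0 ?sqrtr_ge0.
have iZ k m := integrable_wallisZ k m.
rewrite RintegralD //; [|exact: (integrableD _ (iZ _ _) (iZ _ _))|exact: integrable_wallis].
rewrite RintegralD // !RintegralZl //; try exact: integrable_wallis.
rewrite -!/(W _) => h; have W0 := wallis_gt0 n.
have := mulr_ge0 (ltW W0) h.
rewrite (_ : W n * (_ + W n.+2) = W n * W n.+2 - W n.+1 ^+ 2) ?subr_ge0 //.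
by rewrite /l; field; rewrite gt_eqF.
Qed.


(** The two consecutive ratios have product (n+3) / (n+2) by the recurrence, and log-convexity makes
    the first the larger. So the product lies between their squares. *)
Lemma wallis_ratio_bounds n :
  n.+3%:R / n.+2%:R <= (W n / W n.+1) ^+ 2 /\
  (W n.+1 / W n.+2) ^+ 2 <= n.+3%:R / n.+2%:R.
Proof.
have W0 := wallis_gt0 n; have W1 := wallis_gt0 n.+1; have W2 := wallis_gt0 n.+2.
have -> : n.+3%:R / n.+2%:R = W n / W n.+2 :> R.
  by apply/eqP; rewrite eqr_div ?pnatr_eq0 ?(gt_eqF W2) // wallis_rec mulrC.
have h := wallis_log_convex n.
split; rewrite expr_div_n.
  rewrite ler_pdivrMr // mulrAC ler_pdivlMr ?exprn_gt0 //.
  by rewrite expr2 -!mulrA ler_pM2l // -expr2.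
rewrite ler_pdivrMr ?exprn_gt0 // mulrAC ler_pdivlMr //.
by rewrite (expr2 (W n.+2)) mulrA ler_pM2r.
Qed.

(** Consecutive quotients of the [kappa] are Wallis integrals, so only one ratio of these
    survives. *)
Lemma gammaE n : gamma R n.+2 = n.+1%:R * (W n / W n.+1).
Proof.
rewrite /gamma subSS subn0 subn2 /= !kappaE !big_ord_recr /=.
have P0 : \prod_(k < n) W k != 0 by apply/prodf_neq0 => k _; rewrite gt_eqF ?wallis_gt0.
rewrite -(natr1 n.+1) addrK.
by field; rewrite P0 !gt_eqF ?wallis_gt0.
Qed.

Lemma kappa_gt0 n : 0 < kappa R n.
Proof. by rewrite kappaE; apply: prodr_gt0 => k _; exact: wallis_gt0. Qed.

Lemma gamma_sqr_bounds n :
  n.+2%:R ^+ 2 * (n.+3%:R / n.+4%:R) <= 0 :> R.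
Abort.

End WallisIntegrals.

(** * Limits of the constants *)

Section Limits.
Variable R : realType.
Implicit Types (u v : nat -> R) (x : R).

Lemma cvg_natV : (fun n : nat => n%:R^-1 : R) @ \oo --> (0 : R).
Proof.
rewrite -(cvg_shiftn 1); under eq_fun do rewrite addn1; exact: cvg_harmonic.
Qed.

Lemma cvg_sqrt_natV : (fun n : nat => Num.sqrt n%:R^-1 : R) @ \oo --> (0 : R).
Proof.
rewrite -[X in _ --> X]sqrtr0.
exact: (cvg_comp _ Num.sqrt cvg_natV (@sqrt_continuous R 0)).
Qed.

(** The inequality 1 + y <= exp y at y = - x / (1 + x), inverted. *)
Lemma expR_le1D x : -1 < x -> expR (x / (1 + x)) <= 1 + x.
Proof.
move=> x1; have x10 : 0 < 1 + x by lra.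
have := expR_ge1Dx (- (x / (1 + x))).
rewrite expRN (_ : 1 + - _ = (1 + x)^-1); last by field; rewrite gt_eqF.
by rewrite lef_pV2 // posrE ?expR_gt0.
Qed.

(** Squeeze between exp (n u / (1 + u)) and exp (n u). Convergence of n u forces u to 0, so both
    exponents have the same limit. *)
Lemma cvg_1D_expn u x : (fun n => n%:R * u n) @ \oo --> x ->
  (fun n => (1 + u n) ^+ n) @ \oo --> expR x.
Proof.
move=> nu.
have u0 : u @ \oo --> (0 : R).
  rewrite -[X in _ --> X](mul0r x).
  apply: cvg_trans (cvgM cvg_natV nu); apply: near_eq_cvg; near=> n.
  rewrite /= mulKf // pnatr_eq0 -lt0n; near: n; exact: nbhs_infty_gt.
have cexp v y : v @ \oo --> y -> (fun n => expR (v n)) @ \oo --> expR y.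
  by move=> vy; exact: (cvg_comp _ _ vy (@continuous_expR R y)).
have v1 : (fun n => n%:R * u n / (1 + u n)) @ \oo --> x.
  rewrite -[X in _ --> X]divr1; apply: cvgM => //; apply: cvgV => //.
  by rewrite -[X in _ --> X]addr0; apply: cvgD => //; exact: cvg_cst.
apply: (squeeze_cvgr _ (cexp _ _ v1) (cexp _ _ nu)); near=> n.
have un : -1 < u n.
  by near: n; apply: (cvgr_gt 0 u0); rewrite ltrN10.
have un0 : 0 <= 1 + u n by lra.
by rewrite -mulrA !expRM_natl !lerXn2r ?nnegrE ?expR_ge0 ?expR_ge1Dx ?expR_le1D.
Unshelve. all: by end_near. Qed.

Lemma cvg_1N_natV : (fun n : nat => (1 - n%:R^-1) ^+ n) @ \oo --> expR (-1 : R).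
Proof.
apply: cvg_1D_expn; apply: cvg_near_cst; near=> n.
by rewrite mulrN mulfV // pnatr_eq0 -lt0n; near: n; exact: nbhs_infty_gt.
Unshelve. all: by end_near. Qed.

Lemma expR_halfN2 : expR (- 2^-1) ^+ 2 = expR (- 1) :> R.
Proof. by rewrite -expRM_natl; congr expR; field. Qed.

(** Allows limits to be computed for squares, where the square roots disappear. Nonnegativity is
    only eventual because [gamma] has no controlled sign at small indices. *)
Lemma cvg_sqr_root u x : (\forall n \near \oo, 0 <= u n) ->
  (fun n => u n ^+ 2) @ \oo --> x ^+ 2 -> 0 <= x -> u @ \oo --> x.
Proof.
move=> u0 ux x0; rewrite -(ger0_norm x0) -sqrtr_sqr.
apply: cvg_trans (cvg_comp _ Num.sqrt ux (@sqrt_continuous R _)).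
apply: near_eq_cvg; near=> n; rewrite /= sqrtr_sqr ger0_norm //.
by near: n.
Unshelve. all: by end_near. Qed.

(** For n = m + 3 the quotient is (1 - 1/n) W(m+1) / W(m+2). The squared Wallis ratio is at least 1
    + 1/n (bounds at m + 1) and at most 1 / (1 - 1/n) (bounds at m). *)
Lemma gamma_sqr_bounds n : (3 <= n)%N ->
  (1 - n%:R^-1) ^+ 2 * (1 + n%:R^-1) <= (gamma R n / n%:R) ^+ 2 <= 1 - n%:R^-1.
Proof.
case: n => [|[|[|m]]] // _.
have -> : gamma R m.+3 / m.+3%:R = m.+2%:R / m.+3%:R * (wallis R m.+1 / wallis R m.+2).
  by rewrite gammaE mulrAC.
rewrite exprMn.
have -> : m.+2%:R / m.+3%:R = 1 - m.+3%:R^-1 :> R.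
  by rewrite -(natr1 m.+2); field.
have [_ hu] := wallis_ratio_bounds R m.
have [hl _] := wallis_ratio_bounds R m.+1.
have n0 : m.+3%:R^-1 < 1 :> R by rewrite invf_lt1 ?ltr1n ?ltr0n.
apply/andP; split.
  rewrite ler_pM2l ?exprn_gt0 ?subr_gt0 //; apply: le_trans hl.
  by rewrite -(natr1 m.+3) mulrDl mulfV ?pnatr_eq0 // mul1r.
apply: le_trans (_ : (1 - m.+3%:R^-1) ^+ 2 * (m.+3%:R / m.+2%:R) <= _).
  by rewrite ler_pM2l ?exprn_gt0 ?subr_gt0.
rewrite le_eqVlt; apply/orP; left; apply/eqP; rewrite -!(natr1 m.+2).
by field; rewrite -natrD natr1 !pnatr_eq0.
Qed.

Lemma cvg_gamma :
  (fun n => (gamma R n / n%:R) ^+ n) @ \oo --> expR (- 2^-1 : R).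
Proof.
apply: cvg_sqr_root; last exact: expR_ge0.
  near=> n; rewrite exprn_ge0 // divr_ge0 // /gamma.
  rewrite divr_ge0 ?mulr_ge0 ?exprn_ge0 ?(ltW (kappa_gt0 _ _)) // subr_ge0 ler1n.
  near: n; exact: nbhs_infty_gt.
rewrite expR_halfN2.
rewrite (_ : (fun _ => _) = (fun n => (1 + ((gamma R n / n%:R) ^+ 2 - 1)) ^+ n)); last first.
  by apply/funext => n; rewrite exprAC addrCA subrr addr0.
apply: cvg_1D_expn.
(* This is n times the lower bound minus 1, expanded; the upper bound gives exactly -1. *)
have h1 : (fun n : nat => -1 - n%:R^-1 + n%:R^-1 ^+ 2) @ \oo --> (-1 : R).
  rewrite [X in _ --> X](_ : -1 = -1 - 0 + 0 * 0 :> R); last by ring.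
  apply: cvgD; last by under eq_fun do rewrite expr2; apply: cvgM; exact: cvg_natV.
  by apply: cvgB; [exact: cvg_cst|exact: cvg_natV].
apply: (squeeze_cvgr _ h1 (cvg_cst (-1 : R))); near=> n.
have n0 : 0 < n%:R :> R by rewrite ltr0n; near: n; exact: nbhs_infty_gt.
have /andP[hl hu] : (1 - n%:R^-1) ^+ 2 * (1 + n%:R^-1) <= (gamma R n / n%:R) ^+ 2 <= 1 -
  n%:R^-1.
  apply: gamma_sqr_bounds; near: n; exact: nbhs_infty_ge.
have nE : n%:R * n%:R^-1 = 1 :> R by rewrite mulfV // gt_eqF.
have [d [dE d0]] : exists d : R, d = n%:R^-1 /\ 0 < d.
  by exists n%:R^-1; rewrite invr_gt0.
move: hl hu nE; rewrite -dE; set g := (gamma R n * d) ^+ 2; set N := n%:R => hl hu nE.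
apply/andP; split.
  have : N * ((1 - d) ^+ 2 * (1 + d)) <= N * g by rewrite ler_pM2l.
  rewrite (_ : N * (_ * _) = N - N * d - (N * d) * d + (N * d) * d ^+ 2); last by ring.
  by rewrite nE; lra.
have : N * g <= N * (1 - d) by rewrite ler_pM2l.
by rewrite mulrBr nE; lra.
Unshelve. all: by end_near. Qed.

End Limits.

(** * Growth of the Gamma function and of [alpha] *)

Section GammaFunction.
Variable R : realType.
Local Notation mu := (@lebesgue_measure R).

(** The extended-valued integral behind [Gamma], so that finiteness can be proved before [fine] is
    taken. *)
Definition gamma_integral (n : nat) : \bar R :=
  \int[mu]_(t in `]0%R, +oo[) (t `^ (n%:R - 1) * expR (- t))%:E.

Lemma measurable_gamma_integrand (x : R) (D : set R) :
  measurable_fun D (fun t : R => (t `^ x * expR (- t))%:E).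
Proof.
apply/measurable_EFinP/measurable_funTS; apply: measurable_funM.
  exact: measurable_powR.
by apply: measurableT_comp => //; exact: measurable_expR.
Qed.

Lemma measurable_expRN (r : R) (D : set R) :
  measurable_fun D (fun t : R => (expR (- (r * t)))%:E).
Proof.
apply/measurable_EFinP/measurable_funTS.
apply: measurableT_comp; first exact: measurable_expR.
by apply: measurableT_comp => //; exact: mulrl_measurable.
Qed.

Lemma integral_expRN (r : R) : 0 < r ->
  (\int[mu]_(t in `]0%R, +oo[) (expR (- (r * t)))%:E = r^-1%:E)%E.
Proof.
move=> r0; rewrite integral_itv_obnd_cbnd; last exact: measurable_expRN.
have := integral_exponential_pdf r0.
rewrite (_ : (\int[mu]_x _)%E =
    (\int[mu]_(t in `[0%R, +oo[) (r%:E * (expR (- (r * t)))%:E))%E); last first.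
  rewrite [RHS]integral_mkcond; apply: eq_integral => t _.
  rewrite /exponential_pdf !patchE; case: ifP => // _.
  by rewrite -EFinM mulNr.
rewrite ge0_integralZl //; last 2 first.
- exact: measurable_expRN.
- by rewrite lee_fin ltW.
move=> h; rewrite -[LHS]mul1e -[1%E](_ : (r^-1%:E * r%:E)%E = 1%E).
  by rewrite -muleA h mule1.
by rewrite -EFinM mulVf // gt_eqF.
Qed.

(** From 1 + x <= exp x at x = t/n - 1 comes t <= n exp (t/n - 1). The (n-1)-th power leaves a
    factor exp (- t/n), whose integral is n. *)
Lemma gamma_integral_upper n : (0 < n)%N ->
  (gamma_integral n <= (n%:R * (n%:R * expR (- 1)) ^+ n.-1)%:E)%E.
Proof.
move=> n0; have n0' : 0 < n%:R :> R by rewrite ltr0n.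
apply: le_trans (_ : \int[mu]_(t in `]0%R, +oo[)
    (((n%:R * expR (- 1)) ^+ n.-1)%:E * (expR (- (n%:R^-1 * t)))%:E) <= _)%E.
  apply: ge0_le_integral => //.
  - by move=> t _; rewrite lee_fin mulr_ge0 ?powR_ge0 ?expR_ge0.
  - exact: measurable_gamma_integrand.
  - by apply: emeasurable_funM => //; exact: measurable_expRN.
  move=> t; rewrite /= in_itv /= andbT => t0; rewrite lee_fin.
  have -> : n%:R - 1 = n.-1%:R :> R by rewrite -subn1 natrB.
  rewrite powR_mulrn ?(ltW t0) //.
  have h : t <= n%:R * expR (n%:R^-1 * t - 1).
    have := expR_ge1Dx (n%:R^-1 * t - 1); rewrite addrC subrK => h.
    by rewrite -(ler_pM2l n0') mulrA mulfV ?gt_eqF // mul1r in h.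
  apply: le_trans (_ : (n%:R * expR (n%:R^-1 * t - 1)) ^+ n.-1 * expR (- t) <= _).
    by rewrite ler_pM2r ?expR_gt0 // lerXn2r // nnegrE ?(ltW t0) // mulr_ge0 ?expR_ge0.
  rewrite addrC expRD mulrA exprMn -mulrA ler_pM2l ?exprn_gt0 ?mulr_gt0 ?expR_gt0 //.
  rewrite -expRM_natl -expRD ler_expR.
  rewrite le_eqVlt; apply/orP; left; apply/eqP.
  by rewrite -subn1 natrB //; field; rewrite gt_eqF.
rewrite ge0_integralZl //.
- by rewrite integral_expRN ?invr_gt0 // invrK -EFinM lee_fin mulrC.
- exact: measurable_expRN.
Qed.

(** Only the unit interval from n to n + 1 is kept, with both factors replaced by their least values
    there. *)
Lemma gamma_integral_lower n : (0 < n)%N ->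
  ((n%:R ^+ n.-1 * expR (- n.+1%:R))%:E <= gamma_integral n)%E.
Proof.
move=> n0; have n0' : 0 < n%:R :> R by rewrite ltr0n.
have sub : `]n%:R, n.+1%:R] `<=` `]0 : R, +oo[.
  by move=> t /=; rewrite !in_itv /= andbT => /andP[nt _]; exact: lt_trans nt.
apply: (@le_trans _ _ (\int[mu]_(t in `]n%:R, n.+1%:R]) (t `^ (n%:R - 1) * expR (-
  t))%:E)%E); last first.
  apply: ge0_subset_integral => //; first exact: measurable_gamma_integrand.
  by move=> t _; rewrite lee_fin mulr_ge0 ?powR_ge0 ?expR_ge0.
apply: le_trans (_ : \int[mu]_(t in `]n%:R, n.+1%:R])
   ((n%:R ^+ n.-1 * expR (- n.+1%:R))%:E) <= _)%E.
  rewrite integral_cst //= lebesgue_measure_itv /= lte_fin ltr_nat ltnSn.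
  by rewrite -natr1 -EFinB addrAC subrr add0r mule1.
apply: ge0_le_integral => //.
- exact: measurable_gamma_integrand.
move=> t; rewrite /= in_itv /= => /andP[nt tn]; rewrite lee_fin.
have -> : n%:R - 1 = n.-1%:R :> R by rewrite -subn1 natrB.
have t0 : 0 <= t by apply: le_trans (ltW nt).
rewrite powR_mulrn // ler_pM ?exprn_ge0 ?expR_ge0 //.
  by rewrite lerXn2r ?nnegrE // ltW.
by rewrite ler_expR lerN2.
Qed.

Lemma Gamma_bounds n : (0 < n)%N ->
  n%:R ^+ n.-1 * expR (- n.+1%:R) <= Gamma (n%:R : R) <=
  n%:R * (n%:R * expR (- 1)) ^+ n.-1.
Proof.
move=> n0; have GE : Gamma (n%:R : R) = fine (gamma_integral n) by [].
have hu := gamma_integral_upper n0; have hl := gamma_integral_lower n0.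
have fG : gamma_integral n \is a fin_num.
  rewrite fin_numE; apply/andP; split.
    by apply: contraTneq hl => ->.
  by apply: contraTneq hu => ->.
by rewrite GE -!lee_fin fineK // hl.
Qed.

Lemma powR_natVK (y : R) m : 0 <= y -> (0 < m)%N -> (y ^+ m) `^ m%:R^-1 = y.
Proof.
by move=> y0 m0; rewrite -powR_mulrn // -powRrM mulfV ?pnatr_eq0 -?lt0n // powRr1.
Qed.

(** Apply ln x <= x - 1 to the square root of m + 1. It shows that the m-th root of the extra factor
    n in the upper bound of [Gamma_bounds] tends to 1. *)
Lemma ln_le_sqrt m : ln m.+1%:R <= 2 * Num.sqrt m%:R :> R.
Proof.
have m0 : 0 < m.+1%:R :> R by rewrite ltr0n.
rewrite -[in leLHS](sqr_sqrtr (ltW m0)) lnXn ?sqrtr_gt0 // -(mulr_natl (ln _)) ler_pM2l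
  ?ltr0n //.
apply: le_trans (_ : Num.sqrt m.+1%:R - 1 <= _).
  have := @le_ln1Dx R (Num.sqrt m.+1%:R - 1); rewrite [1 + _]addrC subrK; apply.
  by rewrite ltrBrDr addNr sqrtr_gt0.
rewrite lerBlDr -(ler_pXn2r (n := 2)) ?nnegrE ?addr_ge0 ?sqrtr_ge0 //.
rewrite sqr_sqrtr ?(ltW m0) // sqrrD sqr_sqrtr // expr1n mulr1 -natr1 lerD2r lerDl.
by rewrite mulrn_wge0 ?sqrtr_ge0.
Qed.

Lemma cvg_Gamma_root :
  (fun m : nat => m.+1%:R / (Gamma (m.+1%:R : R)) `^ m%:R^-1) @ \oo --> expR (1 : R).
Proof.
have cexp (v : nat -> R) y : v @ \oo --> y -> (fun n => expR (v n)) @ \oo --> expR y.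
  by move=> vy; exact: (cvg_comp _ _ vy (@continuous_expR R y)).
have cl : (fun m : nat => 1 - 2 * Num.sqrt m%:R^-1) @ \oo --> (1 : R).
  rewrite -[X in _ --> X]subr0 -[X in _ - X](mulr0 2).
  by apply: cvgB; [exact: cvg_cst|apply: cvgM; [exact: cvg_cst|exact: cvg_sqrt_natV]].
have cu : (fun m : nat => 1 + 2 * m%:R^-1) @ \oo --> (1 : R).
  rewrite -[X in _ --> X]addr0 -[X in _ + X](mulr0 2).
  by apply: cvgD; [exact: cvg_cst|apply: cvgM; [exact: cvg_cst|exact: cvg_natV]].
apply: (squeeze_cvgr _ (cexp _ _ cl) (cexp _ _ cu)); near=> m.
have m0 : (0 < m)%N by near: m; exact: nbhs_infty_gt.
have mR : 0 < m%:R :> R by rewrite ltr0n.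
have mS : 0 < m.+1%:R :> R by rewrite ltr0n.
have /andP[hl hu] := @Gamma_bounds m.+1 isT.
have G0 : 0 < Gamma (m.+1%:R : R).
  by apply: lt_le_trans hl; rewrite mulr_gt0 ?exprn_gt0 ?expR_gt0.
(* [y] is the m-th root of the lower bound of [Gamma_bounds], since (m + 2) / m = 1 + 2/m. [z]
   dominates the m-th root of the upper bound, through [ln_le_sqrt]. *)
pose y : R := m.+1%:R * expR (- (1 + 2 * m%:R^-1)).
pose z : R := m.+1%:R * expR (- 1 + 2 * Num.sqrt m%:R^-1).
have y0 : 0 < y by rewrite mulr_gt0 ?expR_gt0.
have z0 : 0 < z by rewrite mulr_gt0 ?expR_gt0.
have yG : y <= Gamma (m.+1%:R : R) `^ m%:R^-1.
  rewrite -[leLHS](@powR_natVK _ m) ?(ltW y0) // ge0_ler_powR ?nnegrE ?exprn_ge0 ?(ltW y0)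
    ?(ltW G0) //.
  apply: le_trans hl; rewrite exprMn ler_pM2l ?exprn_gt0 // -expRM_natl ler_expR.
  rewrite le_eqVlt; apply/orP; left; apply/eqP; rewrite -!natr1.
  by field; rewrite gt_eqF.
have Gz : Gamma (m.+1%:R : R) `^ m%:R^-1 <= z.
  rewrite -[leRHS](@powR_natVK _ m) ?(ltW z0) // ge0_ler_powR ?nnegrE ?exprn_ge0 ?(ltW z0)
    ?(ltW G0) //.
  apply: le_trans hu _; rewrite /z expRD mulrA [leRHS]exprMn mulrC ler_pM2l ?exprn_gt0
    ?mulr_gt0 ?expR_gt0 //.
  rewrite -expRM_natl -[leLHS]lnK ?posrE // ler_expR (le_trans (ln_le_sqrt m)) //.
  rewrite mulrCA ler_pM2l //.
  rewrite -{2}(sqr_sqrtr (ltW mR)) sqrtrV ?(ltW mR) // expr2 -mulrA mulfV ?mulr1 //.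
  by rewrite gt_eqF // sqrtr_gt0.
have p0 := lt_le_trans y0 yG.
apply/andP; split.
  rewrite ler_pdivlMr // -(@ler_pM2l _ (expR (-1 + 2 * Num.sqrt m%:R^-1))) ?expR_gt0 //.
  rewrite mulrA -expRD (_ : _ + _ = 0); last by ring.
  by rewrite expR0 mul1r mulrC.
rewrite ler_pdivrMr // -(@ler_pM2l _ (expR (- (1 + 2 * m%:R^-1)))) ?expR_gt0 //.
by rewrite mulrA -expRD addNr expR0 mul1r mulrC.
Unshelve. all: by end_near. Qed.

(** The quotient is (1 - 1/n)^(2n) times n / Gamma(n)^(1/(n-1)), with limits e^(-2) and e. The index
    is shifted to n = m + 1 so that the root has exponent 1/m. *)
Lemma cvg_alpha :
  (fun n => alpha R n / n%:R ^+ (2 * n)) @ \oo --> expR (-1 : R).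
Proof.
have hS : (fun m : nat => (1 + - m.+1%:R^-1) ^+ m.+1) @ \oo --> expR (-1 : R).
  by have := @cvg_1N_natV R; rewrite -(cvg_shiftn 1); under eq_fun do rewrite addn1.
suff : (fun m => alpha R m.+1 / m.+1%:R ^+ (2 * m.+1)) @ \oo --> expR (-1 : R).
  by move=> ?; rewrite -(cvg_shiftn 1); under eq_fun do rewrite addn1.
have eE : expR (- 1) * expR (- 1) * expR 1 = expR (- 1) :> R by rewrite -!expRD addrNK.
rewrite -eE; apply: cvg_trans (cvgM (cvgM hS hS) cvg_Gamma_root).
apply: near_eq_cvg; near=> m; rewrite /alpha /=.
have -> : m.+1%:R - 1 = m%:R :> R by rewrite -natr1 addrK.
have -> : 1 - m.+1%:R^-1 = m%:R / m.+1%:R :> R.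
  by rewrite -natr1; field; rewrite natr1 pnatr_eq0.
rewrite -exprD addnn -mul2n expr_div_n.
by rewrite mulrACA -[RHS]mulrA; congr (_ * _); exact: mulrC.
Unshelve. all: by end_near. Qed.

End GammaFunction.

(** * The sine norm of an orthonormal basis *)

(** The sum of the squares (C a_i - B c_i)^2 equals C (A C - B^2). If C = 0, all c_i vanish and so
    does B. *)
Lemma CauchySchwarz_sum (R : rcfType) (I : finType) (P : pred I) (a c : I -> R) :
  \sum_(i | P i) a i * c i <=
  Num.sqrt (\sum_(i | P i) a i ^+ 2) * Num.sqrt (\sum_(i | P i) c i ^+ 2).
Proof.
set A := \sum_(i | P i) a i ^+ 2; set C := \sum_(i | P i) c i ^+ 2.
set B := \sum_(i | P i) a i * c i.
have A0 : 0 <= A by apply: sumr_ge0 => i _; exact: sqr_ge0.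
have C0 : 0 <= C by apply: sumr_ge0 => i _; exact: sqr_ge0.
have h : 0 <= C * (A * C - B ^+ 2).
  have : 0 <= \sum_(i | P i) (C * a i - B * c i) ^+ 2 by apply: sumr_ge0 => i _; exact: sqr_ge0.
  rewrite (eq_bigr (fun i => C ^+ 2 * a i ^+ 2 + (- (2 * C * B)) * (a i * c i) + B ^+ 2 * c
    i ^+ 2)); last first.
    by move=> i _; ring.
  rewrite !big_split -!mulr_sumr /= -/A -/B -/C.
  by rewrite (_ : _ + B ^+ 2 * C = C * (A * C - B ^+ 2)) //; ring.
rewrite -sqrtrM //; apply: le_trans (ler_norm _) _; rewrite -sqrtr_sqr ler_wsqrtr //.
move: C0; rewrite le_eqVlt => /predU1P[C0|C0]; last by rewrite -subr_ge0 -(pmulr_rge0 _ C0).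
suff -> : B = 0 by rewrite expr0n mulr_ge0 // -C0.
apply: big1 => i Pi; suff /eqP -> : c i == 0 by rewrite mulr0.
have /psumr_eq0P : \sum_(i | P i) c i ^+ 2 = 0 by rewrite -/C.
by move=> /(_ (fun i _ => sqr_ge0 _)) /(_ i Pi) /eqP; rewrite sqrf_eq0.
Qed.

Section SineNorm.
Variables (R : realType) (n : nat) (b : 'I_n -> 'rV[R]_n).
Hypothesis parseval : forall x, dotp x x = \sum_i dotp x (b i) ^+ 2.
Hypothesis ortho : orthonormal_basis b.
Implicit Types (x y t : 'rV[R]_n) (e r : R).

Definition sine_norm x : R := \sum_i Num.sqrt (dotp x x - dotp x (b i) ^+ 2).

(** Polarisation of the Parseval identity. *)
Lemma dotp_coords x y : dotp x y = \sum_i dotp x (b i) * dotp y (b i).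
Proof.
have := parseval (x + y); rewrite !dotpDl !dotpDr (dotpC y x).
rewrite (eq_bigr (fun i => dotp x (b i) ^+ 2 + 2 * (dotp x (b i) * dotp y (b i)) + dotp y
  (b i) ^+ 2)); last first.
  by move=> i _; rewrite dotpDl; ring.
rewrite !big_split /= -!parseval -mulr_sumr; lra.
Qed.

Lemma coord_sqr_le x i : dotp x (b i) ^+ 2 <= dotp x x.
Proof.
rewrite parseval (bigD1 i) //= lerDl; apply: sumr_ge0 => j _; exact: sqr_ge0.
Qed.

Lemma sum_coord_sqrN x i :
  \sum_(j | j != i) dotp x (b j) ^+ 2 = dotp x x - dotp x (b i) ^+ 2.
Proof. by rewrite parseval [in RHS](bigD1 i) //= addrAC subrr add0r. Qed.

(** Cauchy-Schwarz against the constant 1: by Parseval the squared summands add up to (n - 1)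
    |x|^2. *)
Lemma sine_norm_ub x : (0 < n)%N ->
  sine_norm x <= Num.sqrt (n%:R * (n%:R - 1)) * enorm x.
Proof.
move=> n0; have n1 : 0 <= n%:R - 1 :> R by rewrite subr_ge0 ler1n.
have := CauchySchwarz_sum xpredT (fun i => Num.sqrt (dotp x x - dotp x (b i) ^+ 2)) (fun=> 1).
under eq_bigr do rewrite mulr1.
under [X in Num.sqrt X * _]eq_bigr do rewrite sqr_sqrtr ?subr_ge0 ?coord_sqr_le //.
under [X in _ * Num.sqrt X]eq_bigr do rewrite expr1n.
rewrite sumrB -parseval !sumr_const card_ord => /le_trans; apply.
rewrite -[dotp x x *+ n]mulr_natr -[X in _ - X]mulr1 -mulrBr.
rewrite !sqrtrM ?dotpxx_ge0 ?ler0n //.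
by rewrite le_eqVlt; apply/orP; left; apply/eqP; rewrite /enorm; ring.
Qed.

(** After multiplication by |x|, each summand is at least |x|^2 - (x . b_i)^2, and these add up to
    (n - 1) |x|^2. *)
Lemma sine_norm_lb x : (n%:R - 1) * enorm x <= sine_norm x.
Proof.
have : enorm x * ((n%:R - 1) * enorm x) <= enorm x * sine_norm x.
  rewrite mulrCA -expr2 sqr_enorm mulrBl mul1r mulr_natl {2}parseval.
  rewrite -[X in _ *+ X]card_ord -sumr_const -sumrB mulr_sumr.
  apply: ler_sum => i _; have h := coord_sqr_le x i.
  rewrite -sqrtrM ?dotpxx_ge0 // -[leLHS]ger0_norm ?subr_ge0 // -sqrtr_sqr ler_wsqrtr //.
  by rewrite expr2 ler_wpM2r ?subr_ge0 // gerBl sqr_ge0.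
have := enorm_ge0 x; rewrite le_eqVlt => /predU1P[<- _|x0]; last by rewrite ler_pM2l.
by rewrite mulr0; apply: sumr_ge0 => i _; exact: sqrtr_ge0.
Qed.

(** No single coordinate dominates; for such vectors the constant n - 1 of [sine_norm_lb] improves
    to nearly n - 1/2. *)
Definition flat e x : Prop := forall i, dotp x (b i) ^+ 2 <= e * dotp x x.

Lemma sine_norm_lb_flat e x : 0 <= e <= 1 -> flat e x ->
  (n%:R - (1 + e) / 2) * enorm x <= sine_norm x.
Proof.
move=> /andP[e0 e1] fx.
(* For [0 <= t <= e <= 1], [1 - (1 + e) / 2 * t <= sqrt (1 - t)]. *)
have : enorm x * ((n%:R - (1 + e) / 2) * enorm x) <= enorm x * sine_norm x.
  rewrite mulrCA -expr2 sqr_enorm mulrBl mulr_natl {2}parseval mulr_sumr.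
  rewrite -[X in _ *+ X]card_ord -sumr_const -sumrB mulr_sumr.
  apply: ler_sum => i _; have h := coord_sqr_le x i; have := fx i.
  have := sqr_ge0 (dotp x (b i)).
  move: h; set t := dotp x (b i) ^+ 2; have := dotpxx_ge0 x; rewrite /enorm.
  set d := dotp x x => d0 td t0 te.
  have k0 : 0 <= d - (1 + e) / 2 * t by nra.
  rewrite -sqrtrM // -[leLHS]ger0_norm // -sqrtr_sqr ler_wsqrtr //.
  (* Squaring the goal reduces it to (1 + e)^2 t^2 <= 4 e d t, which holds since (1 + e)^2 <= 4 and
     t <= e d. *)
  have : (1 + e) ^+ 2 * t * t <= 4 * (e * d) * t.
    apply: ler_wpM2r => //; apply: ler_pM => //; first exact: sqr_ge0.
    by rewrite (_ : 4 = (1 + 1) ^+ 2 :> R); [rewrite lerXn2r // ?nnegrE; lra|ring].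
  nra.
have := enorm_ge0 x; rewrite le_eqVlt => /predU1P[<- _|x0]; last by rewrite ler_pM2l.
by rewrite mulr0; apply: sumr_ge0 => i _; exact: sqrtr_ge0.
Qed.

(* A pair of balls: by [not_flat_cap] they cover the points [x]
   of the ball of radius [r] such that [(x . b j)^2 > e |x|^2]. *)
Definition cap e r (j : 'I_n) : set 'rV[R]_n :=
  cball ((r * Num.sqrt e) *: b j) (r * Num.sqrt (1 - e)) `|`
  cball (- ((r * Num.sqrt e) *: b j)) (r * Num.sqrt (1 - e)).

(** If x . b_j >= sqrt e |x|, then the squared distance from x to r sqrt e b_j is at most |x|^2 - 2
    e r |x| + e r^2, and this is at most r^2 (1 - e). *)
Lemma not_flat_cap e r x : 0 <= e -> e <= 2^-1 -> 0 <= r -> enorm x <= r ->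
  flat e x \/ exists j, cap e r j x.
Proof.
move=> e0 e1 r0 xr.
have [?|/existsNP[j nj]] := pselect (flat e x); [by left|right; exists j].
move/negP: nj; rewrite -ltNge => hj.
have e2 : 0 <= 1 - e by lra.
(* Replacing x by - x exchanges the two balls of the cap. *)
wlog xb : x xr hj / 0 <= dotp x (b j).
  move=> wl; have [|xb] := leP 0 (dotp x (b j)); first exact: wl.
  have [|||hx|hx] := wl (- x).
  - by rewrite enormN.
  - by rewrite !dotpNl dotpNr opprK sqrrN.
  - by rewrite dotpNl oppr_ge0 ltW.
  - by right; move: hx; rewrite /cball /= -enormN opprD !opprK.
  - by left; move: hx; rewrite /cball /= -enormN opprD !opprK.
left; rewrite /cball /= enorm_le ?mulr_ge0 ?sqrtr_ge0 //.
have xr2 : dotp x x <= r ^+ 2 by rewrite -enorm_le.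
set s := Num.sqrt e; have s0 : 0 <= s by exact: sqrtr_ge0.
have s2 : s ^+ 2 = e by rewrite sqr_sqrtr.
rewrite exprMn sqr_sqrtr // dotpDl !dotpDr !dotpNl !dotpNr opprK !dotpZl !dotpZr.
rewrite (dotpC (b j) x) ortho eqxx mulr1 -sqr_enorm.
have hs : s * enorm x <= dotp x (b j).
  rewrite -(ler_pXn2r (n := 2)) ?nnegrE ?mulr_ge0 ?enorm_ge0 // exprMn s2 sqr_enorm.
  exact: ltW.
have x0 := enorm_ge0 x.
have : r * s * (s * enorm x) <= r * s * dotp x (b j) by apply: ler_wpM2l => //; rewrite
  mulr_ge0.
rewrite (_ : r * s * (s * enorm x) = e * r * enorm x); last by rewrite -s2; ring.
have -> : r * s * (r * s) = r ^+ 2 * e by rewrite -s2; ring.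
(* This product is the slack in the last inequality; its second factor is at least |x| because e <=
   1/2. *)
have : 0 <= (r - enorm x) * (enorm x + r - 2 * r * e).
  by apply: mulr_ge0; [lra|nra].
nra.
Qed.

(** Cauchy-Schwarz over j != i bounds the i-th summand of the norm below by w_i times the sum of |x
    . b_j| |t . b_j|. After exchanging the sums, the j-th product has weight \sum_(i != j) w_i,
    which is at least l. *)
Lemma dotp_le_sine_norm e x t : e < 1 -> enorm t = 1 -> flat e t ->
  0 <= n%:R + 2^-1 - (Num.sqrt (1 - e))^-1 ->
  (n%:R + 2^-1 - (Num.sqrt (1 - e))^-1) * dotp x t <= sine_norm x.
Proof.
set l := _ - _ => e1 t1 ft l0.
have t2 : dotp t t = 1 by rewrite -sqr_enorm t1 expr1n.
pose q i := 1 - dotp t (b i) ^+ 2.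
have qe i : 1 - e <= q i by have := ft i; rewrite t2 /q; lra.
have q0 i : 0 < q i by apply: lt_le_trans (qe i); lra.
pose w i := (Num.sqrt (q i))^-1.
have w0 i : 0 <= w i by rewrite invr_ge0 sqrtr_ge0.
(* The full sum of the w_i is at least n + |t|^2 / 2 = n + 1/2, and flatness bounds the omitted w_j
   by (1 - e)^(-1/2). *)
have Ww j : l <= \sum_(i | i != j) w i.
  have -> : \sum_(i | i != j) w i = \sum_i w i - w j.
    by rewrite [X in X - _](bigD1 j) //= addrAC subrr add0r.
  apply: lerB; last first.
    by rewrite lef_pV2 ?posrE ?sqrtr_gt0 ?q0 ?ler_wsqrtr //; lra.
  have -> : n%:R + 2^-1 = \sum_i (1 + dotp t (b i) ^+ 2 / 2) :> R.
    by rewrite big_split /= sumr_const card_ord -mulr_suml -parseval t2 mul1r.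
  (* For [0 <= t < 1], [1 + t / 2 <= 1 / sqrt (1 - t)]. *)
  apply: ler_sum => i _.
  rewrite /w -[leRHS]div1r ler_pdivlMr ?sqrtr_gt0 ?q0 // -[leRHS]ger0_norm // -ler_sqr;
    last 2 first.
  - by rewrite nnegrE mulr_ge0 ?sqrtr_ge0 // addr_ge0 // divr_ge0 ?sqr_ge0.
  - by rewrite nnegrE normr_ge0.
  rewrite exprMn sqr_sqrtr ?(ltW (q0 i)) // normr1 expr1n.
  have := q0 i; rewrite /q; have := sqr_ge0 (dotp t (b i)).
  by set z := _ ^+ 2 => z0 z1; nra.
apply: le_trans (_ : \sum_j `|dotp x (b j)| * `|dotp t (b j)| * (\sum_(i | i != j) w i) <= _).
  apply: le_trans (_ : l * \sum_j `|dotp x (b j)| * `|dotp t (b j)| <= _).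
    apply: ler_wpM2l => //; rewrite dotp_coords; apply: ler_sum => j _.
    by rewrite -normrM ler_norm.
  rewrite mulr_sumr; apply: ler_sum => j _; rewrite mulrC.
  by apply: ler_wpM2l; rewrite ?mulr_ge0.
under eq_bigr do rewrite mulr_sumr.
rewrite (exchange_big_dep xpredT) //=; apply: ler_sum => i _.
rewrite -mulr_suml /w ler_pdivrMr ?sqrtr_gt0 ?q0 //.
have := CauchySchwarz_sum (fun j => i != j) (fun j => `|dotp x (b j)|) (fun j => `|dotp t
  (b j)|).
under [X in Num.sqrt X * _]eq_bigr do rewrite real_normK ?num_real //.
under [X in _ * Num.sqrt X]eq_bigr do rewrite real_normK ?num_real //.
under [X in Num.sqrt X * _]eq_bigl do rewrite eq_sym.
under [X in _ * Num.sqrt X]eq_bigl do rewrite eq_sym.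
by rewrite !sum_coord_sqrN t2.
Qed.

End SineNorm.

(** * Volumes of the two bodies *)

Section VolumeComparison.
Variables (R : realType) (n : nat).
Implicit Types A B : set 'rV[R]_n.

Lemma le_ext_volume A B : closed A -> closed B -> A `<=` B ->
  (ext_volume A <= ext_volume B)%E.
Proof.
move=> cA cB AB; apply: le_measure.
- by rewrite inE; exact: measurable_preimage_closed.
- by rewrite inE; exact: measurable_preimage_closed.
- by move=> p; exact: AB.
Qed.

Lemma ext_volumeU A B : closed A -> closed B ->
  (ext_volume (A `|` B) <= ext_volume A + ext_volume B)%E.
Proof. by move=> cA cB; apply: measureU2; exact: measurable_preimage_closed. Qed.

Lemma ext_volume_bigsetU (I : finType) (C : I -> set 'rV[R]_n) :
  (forall i, closed (C i)) ->
  (ext_volume (\big[setU/set0]_i C i) <= \sum_i ext_volume (C i))%E.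
Proof.
move=> cC.
(* Closedness is carried through the induction, since subadditivity needs measurable sets at every
   step. *)
suff [] : closed (\big[setU/set0]_i C i) /\
  (ext_volume (\big[setU/set0]_i C i) <= \sum_i ext_volume (C i))%E by [].
apply: (big_ind2 (fun A (v : \bar R) => closed A /\ (ext_volume A <= v)%E)) => //.
- by split; [exact: closed0|rewrite /ext_volume preimage_set0 measure0].
- move=> A v B w [cA Av] [cB Bw]; split; first exact: closedU.
  exact: le_trans (ext_volumeU cA cB) (leeD Av Bw).
Qed.

Lemma le_ext_volume_cover (I : finType) A B (C : I -> set 'rV[R]_n) :
  closed A -> closed B -> (forall i, closed (C i)) ->
  (forall x, A x -> B x \/ exists i, C i x) ->
  (ext_volume A <= ext_volume B + \sum_i ext_volume (C i))%E.
Proof.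
move=> cA cB cC h.
have cU : closed (\big[setU/set0]_i C i).
  by apply: big_ind => //; [exact: closed0|move=> *; exact: closedU].
apply: le_trans (_ : ext_volume (B `|` \big[setU/set0]_i C i) <= _)%E.
  apply: le_ext_volume => //; first exact: closedU.
  by move=> x /h [Bx|[i Cx]]; [left|right; rewrite (bigD1 i) //=; left].
apply: le_trans (ext_volumeU cB cU) _; apply: leeD => //; exact: ext_volume_bigsetU.
Qed.

End VolumeComparison.

(** * Comparison of the unit ball of the sine norm, and of its polar, with Euclidean balls *)

Section SineBodies.
Variables (R : realType) (n : nat) (b : 'I_n -> 'rV[R]_n).
Hypothesis parseval : forall x, dotp x x = \sum_i dotp x (b i) ^+ 2.
Hypothesis ortho : orthonormal_basis b.
Hypothesis n1 : (1 < n)%N.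
Implicit Types (x y t : 'rV[R]_n) (e r : R).

Local Notation N := (n%:R : R).
Local Notation h := (sine_norm b).
Let K : set 'rV[R]_n := [set x | h x <= 1].

Let N1 : 1 < N. Proof. by rewrite ltr1n. Qed.

Let NN : 0 < Num.sqrt (N * (N - 1)).
Proof. by rewrite sqrtr_gt0 mulr_gt0 ?subr_gt0 // (lt_trans ltr01). Qed.

Lemma sine_norm_continuous : continuous h.
Proof.
apply: continuous_big => [|i _ x]; first exact: add_continuous.
apply: (@continuous_comp _ _ _ (fun x => dotp x x - dotp x (b i) ^+ 2) Num.sqrt).
  apply: continuousB; first exact: dotpxx_continuous.
  apply: (@continuous_comp _ _ _ (fun x => dotp x (b i)) (fun x : R => x ^+ 2)).
    exact: dotp_continuous.
  exact: exprn_continuous.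
exact: sqrt_continuous.
Qed.

Lemma closed_sine_ball : closed K.
Proof. by apply: closed_le_continuous; exact: sine_norm_continuous. Qed.

Lemma closed_polar A : closed (@polar R n A).
Proof.
rewrite (_ : polar A = \bigcap_(x in A) [set y | dotp y x <= 1]); last first.
  by apply/seteqP; split => y /= Ay x Ax; have := Ay x Ax; rewrite dotpC.
by apply: closed_bigI => x _; apply: closed_le_continuous; exact: dotp_continuous.
Qed.

Lemma closed_cap e r j : closed (cap b e r j).
Proof. by apply: closedU; exact: closed_cball. Qed.

Lemma ext_volume_cap e r j : 0 <= r ->
  (ext_volume (cap b e r j) <= (2 * ((r * Num.sqrt (1 - e)) ^+ n * kappa R n))%:E)%E.
Proof.
move=> r0; apply: le_trans (ext_volumeU _ _) _; try exact: closed_cball.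
by rewrite !ext_volume_cball_kappa ?mulr_ge0 ?sqrtr_ge0 // -EFinD lee_fin mulrDl !mul1r.
Qed.

Lemma ext_volume_caps e r : 0 <= r ->
  (\sum_j ext_volume (cap b e r j) <=
    (2 * N * ((r * Num.sqrt (1 - e)) ^+ n * kappa R n))%:E)%E.
Proof.
move=> r0; apply: le_trans (lee_sum _ _) _; first by move=> j _; exact: ext_volume_cap.
by rewrite sumEFin lee_fin sumr_const card_ord -[leLHS]mulr_natl mulrCA mulrA.
Qed.

Lemma cball_sub_sine_ball : cball 0 (Num.sqrt (N * (N - 1)))^-1 `<=` K.
Proof.
move=> x; rewrite cball0E /= => hx.
apply: le_trans (sine_norm_ub parseval _ _) _; first exact: ltnW.
by rewrite mulrC -ler_pdivlMr // div1r.
Qed.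

(** The general lower bound puts [K] in the ball of radius 1 / (n - 1). There the caps catch the
    non-flat points, and the sharper bound moves the flat ones into the smaller ball. *)
Lemma sine_ball_cover e x : 0 <= e <= 2^-1 -> K x ->
  cball 0 (N - (1 + e) / 2)^-1 x \/ exists j, cap b e (N - 1)^-1 j x.
Proof.
move=> /andP[e0 e1] Kx; rewrite cball0E.
have N10 : 0 < N - 1 by rewrite subr_gt0.
have Ne : 0 < N - (1 + e) / 2 by lra.
have x1 : enorm x <= (N - 1)^-1.
  by rewrite -[leRHS]mul1r ler_pdivlMr // mulrC (le_trans (sine_norm_lb parseval _)).
have N1i : 0 <= (N - 1)^-1 by rewrite invr_ge0 ltW.
have [fx|hj] := not_flat_cap ortho e0 e1 N1i x1; last by right.
left; rewrite /= -[leRHS]mul1r ler_pdivlMr // mulrC.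
by rewrite (le_trans (sine_norm_lb_flat parseval _ fx)) // e0 /=; lra.
Qed.

(** With c = sqrt (n (n - 1)), the vector y / (c |y|) lies in the ball inscribed in [K]; testing y
    against it gives |y| <= c. *)
Lemma polar_sine_ball_sub : polar K `<=` cball 0 (Num.sqrt (N * (N - 1))).
Proof.
move=> y Ky; rewrite cball0E /=.
have := enorm_ge0 y; rewrite le_eqVlt => /predU1P[<-|y0]; first exact: ltW.
have NN0 := NN; move: NN0; set c := Num.sqrt _ => NN0.
have /Ky : K ((c * enorm y)^-1 *: y).
  apply: cball_sub_sine_ball; rewrite cball0E /= -/c enorm_le ?invr_ge0 ?(ltW NN0) //.
  rewrite dotpZl dotpZr -sqr_enorm invfM mulrA -expr2 exprMn -mulrA -exprMn mulVf ?gt_eqF //.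
  by rewrite expr1n mulr1.
rewrite dotpZl -sqr_enorm invfM expr2 mulrA -[c^-1 * _ * _]mulrA mulVf ?gt_eqF // mulr1.
by rewrite mulrC ler_pdivrMr // mul1r.
Qed.

(** For flat x = |x| t and y in [K] with y . t > 0, one has y . x <= l (y . t) <= h y <= 1. The
    cases x = 0 and y . t <= 0 are immediate. *)
Lemma cball_cover_polar e x : 0 <= e <= 2^-1 ->
  let l := N + 2^-1 - (Num.sqrt (1 - e))^-1 in 0 <= l ->
  cball 0 l x -> polar K x \/ exists j, cap b e l j x.
Proof.
move=> /andP[e0 e1] l l0; rewrite cball0E /= => xl.
have [fx|hj] := not_flat_cap ortho e0 e1 l0 xl; [left|by right].
move=> y Ky.
have := enorm_ge0 x; rewrite le_eqVlt => /predU1P[x0|x0].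
  have xb i : dotp x (b i) = 0.
    apply/eqP; rewrite -sqrf_eq0 eq_le sqr_ge0 andbT.
    by apply: le_trans (coord_sqr_le parseval x i) _; rewrite -sqr_enorm -x0 expr0n.
  by rewrite (dotp_coords parseval) big1 // => i _; rewrite xb mulr0.
pose t := (enorm x)^-1 *: x.
have xt : x = enorm x *: t by rewrite scalerA mulfV ?gt_eqF // scale1r.
have tt : dotp t t = 1.
  by rewrite dotpZl dotpZr -sqr_enorm mulrA -expr2 -exprMn mulVf ?gt_eqF // expr1n.
have t1 : enorm t = 1 by rewrite /enorm tt sqrtr1.
have ft : flat b e t.
  move=> i; rewrite tt mulr1 dotpZl exprMn; have := fx i; rewrite -sqr_enorm => h1.
  by rewrite exprVn ler_pdivrMl ?exprn_gt0 // mulrC.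
rewrite xt dotpZr.
have [yt|yt] := leP (dotp y t) 0.
  by apply: le_trans ler01; rewrite pmulr_rle0.
apply: le_trans (_ : l * dotp y t <= _); first by rewrite ler_pM2r.
apply: le_trans Ky; apply: dotp_le_sine_norm => //; lra.
Qed.

(** Real bounds on both sides exclude infinite values, so [fine] loses nothing. *)
Lemma fine_bounds (v : \bar R) (p q : R) :
  (p%:E <= v)%E -> (v <= q%:E)%E -> p <= fine v <= q.
Proof. by case: v => [v| |] //=; rewrite !lee_fin => -> ->. Qed.

Lemma sine_ball_volume_bounds e : 0 <= e <= 2^-1 ->
  (Num.sqrt (N * (N - 1)))^-1 ^+ n * kappa R n <= volume K <=
  (N - (1 + e) / 2)^-1 ^+ n * kappa R n
    + 2 * N * (((N - 1)^-1 * Num.sqrt (1 - e)) ^+ n * kappa R n).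
Proof.
move=> he; have /andP[e0 e1] := he.
have N10 : 0 <= (N - 1)^-1 by rewrite invr_ge0 subr_ge0 ltW.
have Ne : 0 <= (N - (1 + e) / 2)^-1 by rewrite invr_ge0; have := N1; lra.
rewrite volumeE; apply: fine_bounds.
  rewrite -(ext_volume_cball_kappa 0) ?invr_ge0 ?(ltW NN) //.
  apply: le_ext_volume; [exact: closed_cball|exact: closed_sine_ball|].
  exact: cball_sub_sine_ball.
have := @le_ext_volume_cover R n _ K (cball 0 (N - (1 + e) / 2)^-1) (cap b e (N - 1)^-1)
  closed_sine_ball (@closed_cball _ _ _ _) (@closed_cap _ _) (fun x => @sine_ball_cover e x he).
move=> /le_trans; apply; rewrite EFinD; apply: leeD; last exact: ext_volume_caps.
by rewrite ext_volume_cball_kappa.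
Qed.

(** Here it is the ball that is covered by the polar and the caps, so the volume of the caps is
    subtracted in the lower bound. *)
Lemma polar_sine_ball_volume_bounds e : 0 <= e <= 2^-1 ->
  let l := N + 2^-1 - (Num.sqrt (1 - e))^-1 in 0 <= l ->
  l ^+ n * kappa R n - 2 * N * ((l * Num.sqrt (1 - e)) ^+ n * kappa R n)
    <= volume (polar K) <= Num.sqrt (N * (N - 1)) ^+ n * kappa R n.
Proof.
move=> he l l0; rewrite volumeE; apply: fine_bounds; last first.
  rewrite -(ext_volume_cball_kappa 0) ?(ltW NN) //.
  apply: le_ext_volume; [exact: closed_polar|exact: closed_cball|].
  exact: polar_sine_ball_sub.
have := @le_ext_volume_cover R n _ (cball 0 l) (polar K) (cap b e l)
  (@closed_cball _ _ _ _) (@closed_polar _) (@closed_cap _ _)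
  (fun x => @cball_cover_polar e x he l0).
rewrite ext_volume_cball_kappa // => hl; rewrite EFinB leeBlDr //.
by apply: le_trans hl _; apply: leeD => //; exact: ext_volume_caps.
Qed.

End SineBodies.

(** * Cross measures *)

Section CrossMeasure.
Variables (R : realType) (n : nat).

Lemma measurable_borel_open (U : set 'rV[R]_n) : open U ->
  measurable (U : set (borel_rV R n)).
Proof. exact: sub_sigma_algebra. Qed.

Lemma measurable_borel_closed (A : set 'rV[R]_n) : closed A ->
  measurable (A : set (borel_rV R n)).
Proof.
move=> cA; rewrite -[A]setCK; apply: measurableC.
by apply: measurable_borel_open; exact: closed_openC.
Qed.

Lemma continuous_measurable_borel (D : set 'rV[R]_n) (f : 'rV[R]_n -> R) : continuous f ->
  measurable_fun (D : set (borel_rV R n)) (f : borel_rV R n -> R).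
Proof.
move=> cf; apply: measurable_funTS.
apply: (measurability _ (RGenOpens.measurableE R)) => _ [_ [a [c ->] <-]].
rewrite setTI; apply: measurable_borel_open.
by apply: open_comp; [move=> x _; exact: cf|exact: interval_open].
Qed.

Lemma closed_set1_rV (a : 'rV[R]_n) : closed [set a].
Proof. exact: (accessible_closed_set1 (hausdorff_accessible (@norm_hausdorff R _))). Qed.

Variables (mu : {finite_measure set (borel_rV R n) -> \bar R})
  (b : 'I_n -> 'rV[R]_n) (c : \bar R).
Hypothesis ortho : orthonormal_basis b.
Hypothesis conc : mu (~` [set u | exists i, u = b i \/ u = - b i]) = 0%E.
Hypothesis massb : forall i, mu [set b i] = c /\ mu [set - b i] = c.

(** Enumerates the 2 n atoms by sign and index; injectivity makes the integral a sum over distinct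
    points. *)
Let a (p : bool * 'I_n) : borel_rV R n := if p.1 then b p.2 else - b p.2.

Let a_inj : injective a.
Proof.
have bN i j : b i <> - b j.
  move=> h; have := ortho i i; rewrite {2}h dotpNr ortho eqxx; by case: eqP => _ /=; lra.
have bb i j : b i = b j -> i = j.
  move=> h; have := ortho i i; rewrite {2}h ortho eqxx; case: eqP => // _ /esym/eqP.
  by rewrite oner_eq0.
move=> [[] i] [[] j]; rewrite /a /=.
- by move=> /bb ->.
- by move=> /bN.
- by move=> /esym /bN.
- by move=> /oppr_inj /bb ->.
Qed.

Let D := \big[setU/set0]_(p <- index_enum (bool * 'I_n)%type) [set a p].

Lemma integral_set1_atom (p : bool * 'I_n) (f : 'rV[R]_n -> R) :
  (\int[mu]_(u in [set a p]) (f u)%:E = (f (a p))%:E * c)%E.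
Proof.
transitivity (\int[mu]_(u in [set a p]) (f (a p))%:E)%E.
  by apply: eq_integral => u; rewrite inE => /= ->.
rewrite integral_cst; last by apply: measurable_borel_closed; exact: closed_set1_rV.
congr (_ * _)%E; case: p => -[] i; have [h1 h2] := massb i; rewrite /a /=.
  exact: h1.
exact: h2.
Qed.

(** The complement of the atoms is negligible and the atoms lie on the sphere. Nonnegative f lets
    the common mass c stay an extended real, as its finiteness is proved only later. *)
Lemma integral_cross (f : 'rV[R]_n -> R) : continuous f -> (forall u, 0 <= f u) ->
  (\int[mu]_(u in unit_sphere R n) (f u)%:E =
   \sum_(i < n) ((f (b i))%:E * c + (f (- b i))%:E * c))%E.
Proof.
move=> cf f0.
have mf E : measurable_fun (E : set (borel_rV R n)) (fun u => (f u)%:E).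
  by apply/measurable_EFinP; exact: continuous_measurable_borel.
have m1 p : measurable ([set a p] : set (borel_rV R n)).
  by apply: measurable_borel_closed; exact: closed_set1_rV.
have mS : measurable (unit_sphere R n : set (borel_rV R n)).
  apply: measurable_borel_closed.
  rewrite (_ : unit_sphere R n = (@enorm R n) @^-1` [set 1]) //.
  by apply: closed_comp => [x _|]; [exact: enorm_continuous|exact: closed_eq].
have mD : measurable D by apply: bigsetU_measurable.
have DE : D = [set u | exists i, u = b i \/ u = - b i].
  apply/seteqP; split => u; rewrite /D -bigcup_seq /=.
    by move=> [[[] i] _ ->]; exists i; [left|right].
  by move=> [i [->|->]]; [exists (true, i)|exists (false, i)]; rewrite //= mem_index_enum.
have DS : D `<=` unit_sphere R n.
  by rewrite DE => u [i [->|->]]; rewrite /unit_sphere /= ?enormN /enorm ortho eqxx sqrtr1.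
rewrite (ge0_negligible_integral (N := ~` D)) //; first last.
- by rewrite DE.
- by move=> u _; rewrite lee_fin.
- exact: measurableC.
rewrite setDE setCK setIC (setIidl DS).
rewrite ge0_integral_bigsetU //; last 3 first.
- exact: index_enum_uniq.
- by move=> p q _ _ [u [/= -> /a_inj]].
- by move=> u _; rewrite lee_fin.
rewrite (eq_bigr (fun p => (f (a p))%:E * c)%E); last by move=> p _; exact: integral_set1_atom.
rewrite -(pair_big xpredT xpredT (fun s i => (f (a (s, i)))%:E * c)%E) /=.
by rewrite big_bool /= -big_split.
Qed.

End CrossMeasure.

(** * The sine transform of a cross measure *)

Section SineTransformCross.
Variables (R : realType) (n : nat).
Variable mu : {finite_measure set (borel_rV R n) -> \bar R}.
Hypothesis n0 : (0 < n)%N.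
Hypothesis cross : cross_measure mu.

Lemma cross_measure_sine_norm : exists b : 'I_n -> 'rV[R]_n,
  [/\ orthonormal_basis b, (forall x, dotp x x = \sum_i dotp x (b i) ^+ 2) &
      forall x, sine_transform mu x = sine_norm b x].
Proof.
have [_ iso [b [c [ortho conc massb]]]] := cross.
have cdot x : continuous (fun u : 'rV[R]_n => `|dotp x u| ^+ 2).
  have -> : (fun u => `|dotp x u| ^+ 2) = (fun u => dotp u x * dotp u x).
    by apply/funext => u; rewrite real_normK ?num_real // dotpC expr2.
  by move=> u; apply: (@continuousM R _ (fun u => dotp u x)); exact: dotp_continuous.
have iso' x : ((enorm x ^+ 2)%:E = \sum_(i < n) ((dotp x (b i) ^+ 2)%:E * c + (dotp x (b i)
  ^+ 2)%:E * c))%E.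
  rewrite iso (integral_cross ortho conc massb (cdot x)); last by move=> u; exact: sqr_ge0.
  by apply: eq_bigr => i _; rewrite dotpNr normrN !real_normK ?num_real.
have {massb} [r cE massb] : exists2 r : R, c = r%:E & forall i, mu [set b i] = r%:E /\ mu
  [set - b i] = r%:E.
  have fc : c \is a fin_num.
    rewrite -(massb (Ordinal n0)).1; apply: fin_num_measure.
    by apply: measurable_borel_closed; exact: closed_set1_rV.
  by exists (fine c); rewrite fineK.
have iso2 x : dotp x x = \sum_i dotp x (b i) ^+ 2 * (r + r).
  have := iso' x; rewrite cE sqr_enorm.
  under eq_bigr do rewrite -!EFinM -EFinD -mulrDr.
  by rewrite sumEFin => -[].
(* Isotropy is tested on one basis vector, which exists since n > 0. With 2 r = 1, isotropy becomes
   Parseval. *)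
have r2 : r + r = 1.
  have := iso2 (b (Ordinal n0)); rewrite ortho eqxx (bigD1 (Ordinal n0)) //= ortho eqxx.
  rewrite big1 => [|i ni]; first by rewrite expr1n mul1r addr0.
  by rewrite ortho eq_sym (negbTE ni) expr0n mul0r.
have pars x : dotp x x = \sum_i dotp x (b i) ^+ 2.
  by rewrite {1}iso2; apply: eq_bigr => i _; rewrite r2 mulr1.
exists b; split => // x.
have projE u : dotp u u = 1 -> enorm (proj_perp x u) = Num.sqrt (dotp x x - dotp x u ^+ 2).
  move=> uu; rewrite /enorm /proj_perp dotpDl !dotpDr !dotpNl !dotpNr !dotpZl !dotpZr uu.
  by rewrite (dotpC u x); congr Num.sqrt; ring.
have cproj : continuous (fun u : 'rV[R]_n => enorm (proj_perp x u)).
  move=> u; apply: (@continuous_comp _ _ _ (proj_perp x) (@enorm R n)); last exact: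
    enorm_continuous.
  apply: continuousB; first exact: cst_continuous.
  apply: (@continuousZ R _ _ (fun u => dotp x u) id); last exact: cvg_id.
  by rewrite (_ : (fun u => dotp x u) = (fun u => dotp u x)); [exact:
    dotp_continuous|apply/funext => v; rewrite dotpC].
rewrite /sine_transform /Rintegral.
rewrite (integral_cross ortho conc massb cproj); last by move=> u; exact: enorm_ge0.
under eq_bigr => i _.
  rewrite !projE ?dotpNl ?dotpNr ?opprK ?ortho ?eqxx // sqrrN -!EFinM -EFinD -mulrDr r2 mulr1.
  over.
by rewrite sumEFin.
Qed.

End SineTransformCross.

(** * Asymptotics *)

Section Asymptotics.
Variable R : realType.

(** The choice n^(-1/2) tends to 0, as the radii require, yet n times it grows fast enough to make n
    exp (- n eps / 2) vanish, as the caps require. *)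
Local Notation eps n := (Num.sqrt (n%:R^-1) : R).
Local Notation shrink n := (Num.sqrt (1 - eps n) : R).

Lemma cvg_sqrt_1N_natV :
  (fun n : nat => Num.sqrt (1 - n%:R^-1) ^+ n) @ \oo --> expR (- 2^-1 : R).
Proof.
apply: cvg_sqr_root; last exact: expR_ge0.
  by near=> n; rewrite exprn_ge0 // sqrtr_ge0.
rewrite expR_halfN2; apply: cvg_trans (@cvg_1N_natV R); apply: near_eq_cvg; near=> n.
rewrite exprAC sqr_sqrtr // subr_ge0 invf_le1 ?ler1n ?ltr0n; near: n; exact: nbhs_infty_gt.
Unshelve. all: by end_near. Qed.

Lemma cvg_expn_half (v : nat -> R) : v @ \oo --> (- 2^-1 : R) ->
  (fun n : nat => (1 + v n / n%:R) ^+ n) @ \oo --> expR (- 2^-1 : R).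
Proof.
move=> hv; apply: cvg_1D_expn; apply: cvg_trans hv; apply: near_eq_cvg; near=> n.
by rewrite mulrC divfK // pnatr_eq0 -lt0n; near: n; exact: nbhs_infty_gt.
Unshelve. all: by end_near. Qed.

Lemma cvg_ball_radius :
  (fun n : nat => (1 + (- ((1 + eps n) / 2)) / n%:R) ^+ n) @ \oo --> expR (- 2^-1 : R).
Proof.
apply: cvg_expn_half; rewrite [X in _ --> X](_ : _ = - ((1 + 0) / 2)); last by rewrite
  addr0 mul1r.
apply: cvgN; apply: cvgM; last exact: cvg_cst.
by apply: cvgD; [exact: cvg_cst|exact: cvg_sqrt_natV].
Qed.

(** The base is l / n. Its offset tends to 1/2 - 1 = -1/2, the same limit as for the ball radius in
    [cvg_ball_radius]. *)
Lemma cvg_polar_radius :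
  (fun n : nat => (1 + (2^-1 - (shrink n)^-1) / n%:R) ^+ n) @ \oo --> expR (- 2^-1 : R).
Proof.
apply: cvg_expn_half; rewrite [X in _ --> X](_ : _ = 2^-1 - (Num.sqrt (1 - 0))^-1); last first.
  by rewrite subr0 sqrtr1 invr1; field.
apply: cvgB; first exact: cvg_cst.
apply: cvgV; first by rewrite subr0 sqrtr1 oner_eq0.
apply: (cvg_comp _ Num.sqrt); last exact: sqrt_continuous.
by apply: cvgB; [exact: cvg_cst|exact: cvg_sqrt_natV].
Qed.

(** With q = sqrt n, the power is at most exp (- q/2), hence at most 48 / q^3. The factor 2 n = 2
    q^2 then leaves 96 / q. *)
Lemma cvg_caps : (fun n : nat => 2 * n%:R * shrink n ^+ n) @ \oo --> (0 : R).
Proof.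
have h : (fun n : nat => 96 * eps n) @ \oo --> (0 : R).
  by rewrite -[X in _ --> X](mulr0 96); apply: cvgM; [exact: cvg_cst|exact: cvg_sqrt_natV].
apply: (squeeze_cvgr _ (cvg_cst (0 : R)) h); near=> n.
have n0 : 0 < n%:R :> R by rewrite ltr0n; near: n; exact: nbhs_infty_gt.
rewrite !mulr_ge0 ?exprn_ge0 ?sqrtr_ge0 ?(ltW n0) //=.
set q : R := Num.sqrt n%:R.
have q0 : 0 < q by rewrite sqrtr_gt0.
have q2 : n%:R = q ^+ 2 :> R by rewrite sqr_sqrtr // ltW.
have eE : eps n = q^-1 by rewrite sqrtrV // ltW.
rewrite eE.
have s1 : Num.sqrt (1 - q^-1) <= expR (- (q^-1 / 2)).
  rewrite -(@ger0_norm _ (expR _)) ?expR_ge0 // -sqrtr_sqr ler_wsqrtr // -expRM_natl.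
  rewrite (_ : 2%:R * _ = - q^-1); last by field; rewrite gt_eqF.
  by rewrite expR_ge1Dx.
have s2 : Num.sqrt (1 - q^-1) ^+ n <= expR (- (q / 2)).
  apply: le_trans (_ : expR (- (q^-1 / 2)) ^+ n <= _).
    by rewrite lerXn2r ?nnegrE ?sqrtr_ge0 ?expR_ge0.
  rewrite -expRM_natl ler_expR q2 le_eqVlt; apply/orP; left; apply/eqP.
  by field; rewrite gt_eqF.
(* The cubic Taylor term of exp (q/2); the quadratic one would only give a bounded sequence. *)
have s3 : q ^+ 3 / 48 <= expR (q / 2).
  have := @expR_ge1Dxn R (q / 2) 2 _; rewrite divr_ge0 ?(ltW q0) // => /(_ isT).
  rewrite (_ : 3`!%:R = 6 :> R) // => h3; apply: le_trans h3.
  by rewrite (_ : (q / 2) ^+ 3 / 6 = q ^+ 3 / 48); [lra|field].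
apply: le_trans (_ : 2 * n%:R * (q ^+ 3 / 48)^-1 <= _).
  rewrite ler_pM2l ?mulr_gt0 //; apply: le_trans s2 _.
  by rewrite expRN lef_pV2 ?posrE ?expR_gt0 ?divr_gt0 ?exprn_gt0.
rewrite q2 le_eqVlt; apply/orP; left; apply/eqP.
by field; rewrite gt_eqF.
Unshelve. all: by end_near. Qed.

End Asymptotics.

(** * Assembly of the two limits *)

Theorem theorem4p3 (R : realType)
    (nu : forall n : nat, {finite_measure set (borel_rV R n) -> \bar R})
    (hnu : forall n : nat, (3 <= n)%N -> cross_measure (nu n)) :
  ((fun n : nat => alpha R n / (kappa R n * gamma R n ^+ n)
                   * volume (sine_polar_body (nu n))) @ \oo --> (1 : R)) /\
  ((fun n : nat => gamma R n ^+ n / (kappa R n * alpha R n)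
                   * volume (sine_body (nu n))) @ \oo --> (1 : R)).
Proof.
have eE : expR (- 2^-1) ^+ 2 = expR (- 1) :> R := expR_halfN2 R.
have e0 : expR (- 2^-1) != 0 :> R by rewrite gt_eqF ?expR_gt0.
have e1 : expR (- 1) != 0 :> R by rewrite gt_eqF ?expR_gt0.
have sqrtNN (N : R) : 0 < N -> Num.sqrt (N * (N - 1)) = N * Num.sqrt (1 - N^-1).
  move=> N0; rewrite (_ : _ * _ = N ^+ 2 * (1 - N^-1)); last by field; rewrite gt_eqF.
  by rewrite sqrtrM ?sqr_ge0 // sqrtr_sqr ger0_norm // ltW.
have eps_half : \forall n \near \oo, Num.sqrt (n%:R^-1 : R) <= 2^-1.
  near=> n; apply/ltW; near: n.
  by apply: (cvgr_lt 0); [exact: cvg_sqrt_natV|rewrite invr_gt0].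
have polar_limit : (fun n => n%:R ^+ n / kappa R n * volume (sine_polar_body (nu n)))
    @ \oo --> (expR (- 2^-1))^-1.
  have hl : (fun n : nat => (Num.sqrt (1 - n%:R^-1) ^+ n)^-1 : R) @ \oo --> (expR (- 2^-1))^-1.
    exact: cvgV e0 (@cvg_sqrt_1N_natV R).
  (* The first term is the main ball. The second is the caps, where a factor tending to e multiplies
     a vanishing one. *)
  have hu : (fun n : nat => ((1 + (- ((1 + Num.sqrt n%:R^-1) / 2)) / n%:R) ^+ n)^-1 +
      ((1 - n%:R^-1) ^+ n)^-1 * (2 * n%:R * Num.sqrt (1 - Num.sqrt n%:R^-1) ^+ n) : R)
      @ \oo --> (expR (- 2^-1))^-1.
    rewrite -[(expR _)^-1]addr0 -[X in _ + X](mulr0 (expR (- 1))^-1).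
    apply: cvgD (cvgV e0 (@cvg_ball_radius R)) _.
    exact: cvgM (cvgV e1 (@cvg_1N_natV R)) (@cvg_caps R).
  apply: (squeeze_cvgr _ hl hu); near=> n.
  have n3 : (3 <= n)%N by near: n; exact: nbhs_infty_ge.
  have n1 : (1 < n)%N by exact: leq_trans n3.
  have N1 : 1 < n%:R :> R by rewrite ltr1n.
  have N0 : 0 < n%:R :> R by exact: lt_trans N1.
  have he : 0 <= Num.sqrt (n%:R^-1 : R) <= 2^-1 by rewrite sqrtr_ge0 /=; near: n.
  have [b [ortho pars sE]] := cross_measure_sine_norm (ltnW n1) (hnu _ n3).
  have -> : sine_polar_body (nu n) = [set x | sine_norm b x <= 1].
    by apply/seteqP; split => x; rewrite /sine_polar_body /= sE.
  have /andP[h1 h2] := sine_ball_volume_bounds pars ortho n1 he.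
  have k0 := kappa_gt0 R n.
  have p0 : 0 < n%:R ^+ n / kappa R n :> R by rewrite divr_gt0 ?exprn_gt0.
  apply/andP; split.
    rewrite mulrC -ler_pdivrMr //; apply: le_trans h1; rewrite sqrtNN //.
    by rewrite invf_div exprVn exprMn invfM [kappa R n / _]mulrC mulrA [_^-1 * _^-1]mulrC.
  rewrite mulrC -ler_pdivlMr //; apply: le_trans h2 _.
  set c := (1 + _) / 2; rewrite (_ : n%:R - c = n%:R * (1 + - c / n%:R)); last by field;
    rewrite gt_eqF.
  rewrite (_ : n%:R - 1 = n%:R * (1 - n%:R^-1)); last by field; rewrite gt_eqF.
  rewrite invf_div !exprVn !exprMn !exprVn !exprMn !invfM le_eqVlt; apply/orP; left; apply/eqP.
  by ring.
have body_limit : (fun n => volume (sine_body (nu n)) / (kappa R n * n%:R ^+ n))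
    @ \oo --> expR (- 2^-1).
  have hl : (fun n : nat => (1 + (2^-1 - (Num.sqrt (1 - Num.sqrt n%:R^-1))^-1) / n%:R) ^+ n *
      (1 - 2 * n%:R * Num.sqrt (1 - Num.sqrt n%:R^-1) ^+ n) : R) @ \oo --> expR (- 2^-1).
    rewrite -[expR _]mulr1 -[X in _ * X]subr0.
    apply: cvgM (@cvg_polar_radius R) _.
    by apply: cvgB; [exact: cvg_cst|exact: cvg_caps].
  apply: (squeeze_cvgr _ hl (@cvg_sqrt_1N_natV R)); near=> n.
  have n3 : (3 <= n)%N by near: n; exact: nbhs_infty_ge.
  have n1 : (1 < n)%N by exact: leq_trans n3.
  have N1 : 1 < n%:R :> R by rewrite ltr1n.
  have N0 : 0 < n%:R :> R by exact: lt_trans N1.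
  have he : 0 <= Num.sqrt (n%:R^-1 : R) <= 2^-1 by rewrite sqrtr_ge0 /=; near: n.
  have [b [ortho pars sE]] := cross_measure_sine_norm (ltnW n1) (hnu _ n3).
  have -> : sine_body (nu n) = polar [set x | sine_norm b x <= 1].
    by congr polar; apply/seteqP; split => x; rewrite /sine_polar_body /= sE.
  (* From eps <= 1/2 the root is at least 1/2, so at most 2 is subtracted, and n >= 3. *)
  have l0 : 0 <= n%:R + 2^-1 - (Num.sqrt (1 - Num.sqrt n%:R^-1))^-1 :> R.
    have /andP[_ e2] := he.
    have h4 : 2^-1 <= Num.sqrt (1 - Num.sqrt n%:R^-1) :> R.
      rewrite -[leLHS]ger0_norm ?invr_ge0 // -sqrtr_sqr ler_wsqrtr //.
      by move: e2; set x := Num.sqrt _; lra.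
    have : (Num.sqrt (1 - Num.sqrt n%:R^-1))^-1 <= 2^-1^-1 :> R.
      by rewrite lef_pV2 ?posrE // (lt_le_trans _ h4) ?invr_gt0.
    have : 3 <= n%:R :> R by rewrite ler_nat.
    by rewrite invrK; set x := (Num.sqrt _)^-1; lra.
  have /andP[h1 h2] := polar_sine_ball_volume_bounds pars ortho n1 he l0.
  have k0 := kappa_gt0 R n.
  have p0 : 0 < kappa R n * n%:R ^+ n :> R by rewrite mulr_gt0 ?exprn_gt0.
  apply/andP; split.
    rewrite ler_pdivlMr //; apply: le_trans h1.
    set c := (Num.sqrt (1 - _))^-1; rewrite (_ : n%:R + 2^-1 - c = n%:R * (1 + (2^-1 - c) /
      n%:R)); last first.
      by field; rewrite gt_eqF.
    rewrite !exprMn le_eqVlt; apply/orP; left; apply/eqP; ring.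
  rewrite ler_pdivrMr //; apply: le_trans h2 _; rewrite sqrtNN //.
  by rewrite exprMn mulrC mulrCA mulrA mulrC [n%:R ^+ n * _]mulrC.
split.
(* The factors alpha_n / n^(2n), (gamma_n / n)^(-n) and n^n V / kappa_n tend to e^(-1), e^(1/2) and
   e^(1/2); the powers of n cancel. *)
- have E : expR (- 1) * (expR (- 2^-1))^-1 * (expR (- 2^-1))^-1 = 1 :> R.
    by rewrite -mulrA -expr2 exprVn eE mulfV.
  rewrite -E; apply: cvg_trans (cvgM (cvgM (@cvg_alpha R) (cvgV e0 (@cvg_gamma R)))
    polar_limit).
  apply: near_eq_cvg; near=> n.
  have n0 : n%:R ^+ n != 0 :> R.
    by rewrite expf_neq0 // pnatr_eq0 -lt0n; near: n; exact: nbhs_infty_gt.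
  rewrite /= expr_div_n invf_div mul2n -addnn exprD !invfM.
  move: (mulfV n0); move: (n%:R ^+ n) (n%:R ^+ n)^-1 (kappa R n)^-1 (gamma R n ^+ n)^-1.
  move: (alpha R n) (volume _) => a V N M k g NM.
  transitivity (a * (k * g) * V * (N * M) * (N * M)); first by ring.
  by rewrite NM !mulr1.
(* Dually, the limits are e^(-1/2), e and e^(-1/2). *)
- have E : expR (- 2^-1) * (expR (- 1))^-1 * expR (- 2^-1) = 1 :> R.
    by rewrite mulrAC -expr2 eE mulfV.
  rewrite -E; apply: cvg_trans (cvgM (cvgM (@cvg_gamma R) (cvgV e1 (@cvg_alpha R))) body_limit).
  apply: near_eq_cvg; near=> n.
  have n0 : n%:R ^+ n != 0 :> R.
    by rewrite expf_neq0 // pnatr_eq0 -lt0n; near: n; exact: nbhs_infty_gt.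
  rewrite /= expr_div_n invf_div mul2n -addnn exprD; move: (alpha R n) => A; rewrite !invfM.
  move: (mulfV n0); move: (n%:R ^+ n) (n%:R ^+ n)^-1 (kappa R n)^-1 A^-1.
  move: (gamma R n ^+ n) (volume _) => g V N M k a NM.
  transitivity (g * (k * a) * V * (N * M) * (N * M)); first by ring.
  by rewrite NM !mulr1.
Unshelve. all: by end_near. Qed.
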